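(* Let $\Gamma$ be a $\Phi_d$-complex with an associated invariant simplex $\sigma=\{v_0,v_1,\ldots,v_d\}$, and let $K$ be a pure $d$-dimensional simplicial complex. Then for $m$ even, \[ Coind_{\mathbb{Z}_2}(Hom(\Gamma,K))\geq m\ \Longrightarrow\ \chi(K)\geq m+d+2 . \]
   Context: All simplicial complexes are finite, and $m\ge 0$. $V(K)$ is the vertex set of $K$, $\Delta^S$ is the simplex with vertex set $S$, and $[m]=\{1,\ldots,m\}$. A simplicial map is non-degenerate if it is injective on simplices. The chromatic number $\chi(K)$ is the minimum $m$ for which there is a non-degenerate simplicial map $K\to\Delta^{[m]}$. For finite simplicial complexes $K,L$, the cell complex $Hom(K,L)\subset\prod_{v\in V(K)}\Delta^{V(L)}$ is the union of the cells $c_\eta=\prod_{v\in V(K)}\Delta^{\eta(v)}$ indexed by functions $\eta:V(K)\to 2^{V(L)}\setminus\{\emptyset\}$ such that (1) $\eta(u)\cap\eta(v)=\emptyset$ whenever $u\ne v$ and $\{u,v\}\in K$; (2) for each simplex $\sigma\in K$, the join $\ast_{v\in V(\sigma)}\eta(v)$ of the $0$-dimensional complexes $\eta(v)$ is a subcomplex of $L$, i.e. every set obtained by choosing one element from each $\eta(v)$, $v\in V(\sigma)$, is a simplex of $L$. A non-degenerate simplicial map $f:K\to K'$ induces the continuous map $\widehat f:Hom(K',L)\to Hom(K,L)$, $(p_w)_{w\in V(K')}\mapsto(p_{f(v)})_{v\in V(K)}$, which on cells is $\eta\mapsto\eta\circ f$. In particular a simplicial involution $\omega$ of $\Gamma$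 induces an involution ($\mathbb{Z}_2$-action) $\widehat\omega$ on $Hom(\Gamma,K)$. For a pure $d$-dimensional simplicial complex $\Gamma$ and a $d$-simplex $\sigma$ of $\Gamma$, the group of projectivities $\Pi(\Gamma,\sigma)$ is the group of all permutations of the vertices of $\sigma$ of the form $\overrightarrow{\sigma_0\sigma_1}\ast\cdots\ast\overrightarrow{\sigma_{n-1}\sigma_n}$ (apply the first map first), where $\sigma_0=\sigma_n=\sigma$, each $\sigma_i$ is a $d$-simplex of $\Gamma$, consecutive simplices $\sigma_i,\sigma_{i+1}$ share a common $(d-1)$-face, and $\overrightarrow{\sigma_i\sigma_{i+1}}:\sigma_i\to\sigma_{i+1}$ is the bijection of vertex sets fixing that common face pointwise. A pure $d$-dimensional simplicial complex $\Gamma$ is a $\Phi_d$-complex if it is equipped with a simplicial involution $\omega:\Gamma\to\Gamma$ (is a $\mathbb{Z}_2$-complex) and has an $\omega$-invariant $d$-simplex $\sigma=\{v_0,\ldots,v_d\}$ such that the restriction $\tau:=\omega|_\sigma$ is a non-trivial element of the group $\Pi(\Gamma,\sigma)$. For a $\mathbb{Z}_2$-space $X$, $Coind_{\mathbb{Z}_2}(X)\ge m$ means that there exists a $\mathbb{Z}_2$-equivariant continuous map $S^m\to X$, where $S^m$ carries the antipodal action. *)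

(* Defs.v *)
From HB Require Import structures.
From mathcomp Require Import all_boot all_order all_algebra all_fingroup.
From mathcomp Require Import all_classical all_reals all_analysis.

Set Implicit Arguments.
Unset Strict Implicit.
Unset Printing Implicit Defensive.

Import Order.TTheory GRing.Theory Num.Theory.
Import numFieldNormedType.Exports.

Local Open Scope ring_scope.

(* A finite simplicial complex whose vertex set is the whole finite type V;
   simplices are nonempty and are identified with their vertex sets. *)
Record simplicial_complex (V : finType) := SComplex {
  simplices : {set {set V}};
  complex_neq0 : forall s, s \in simplices -> s != finset.set0;
  complex_vertex : forall v : V, [set v]%SET \in simplices;
  complex_face : forall s t : {set V},
    s \in simplices -> t \subset s -> t != finset.set0 -> t \in simplices
}.

Section Combinatorics.
Variables V W : finType.

Definition simplicial_map (K : simplicial_complex V)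
    (L : simplicial_complex W) (f : V -> W) : Prop :=
  forall s, s \in simplices K -> (f @: s)%SET \in simplices L.

Definition nondegenerate (K : simplicial_complex V) (f : V -> W) : Prop :=
  forall s, s \in simplices K -> {in s &, injective f}.

Definition is_simplex (K : simplicial_complex V) (d : nat) (s : {set V}) :
    bool :=
  (s \in simplices K) && (#|s| == d.+1).

Definition pure (K : simplicial_complex V) (d : nat) : Prop :=
  (exists s, is_simplex K d s) /\
  (forall s, maxset (fun t => t \in simplices K) s -> is_simplex K d s).

End Combinatorics.

Section FullSimplex.
Variable S : finType.

Let full : {set {set S}} := (~: [set finset.set0])%SET.

Fact full_neq0 s : s \in full -> s != finset.set0.
Proof. by rewrite !inE. Qed.

Fact full_vertex (v : S) : [set v]%SET \in full.
Proof. by rewrite !inE -card_gt0 cards1. Qed.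

Fact full_face (s t : {set S}) :
  s \in full -> t \subset s -> t != finset.set0 -> t \in full.
Proof. by rewrite !inE. Qed.

Definition full_simplex : simplicial_complex S :=
  @SComplex S full full_neq0 full_vertex full_face.

End FullSimplex.

Section ChromaticNumber.
Variable V : finType.

Definition colorable (K : simplicial_complex V) (n : nat) : Prop :=
  exists f : V -> 'I_n,
    simplicial_map K (full_simplex 'I_n) f /\ nondegenerate K f.

Lemma colorable_exists (K : simplicial_complex V) :
  exists n, `[< colorable K n >].
Proof.
exists #|V|; apply/asboolP; exists enum_rank; split=> s sK.
- by rewrite !inE imset_eq0 (complex_neq0 sK).
- by move=> x y _ _; apply: enum_rank_inj.
Qed.

Definition chromatic_number (K : simplicial_complex V) : nat :=
  ex_minn (colorable_exists K).

End ChromaticNumber.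

Section Projectivities.
Variable V : finType.

Definition adjacent (d : nat) (A B : {set V}) : bool :=
  [exists F : {set V}, [&& F \subset A, F \subset B & #|F| == d]].

(* When A and B have d + 1 elements and are adjacent, either A = B or each of
   A \ B and B \ A is a single vertex; see perspectivityP. *)
Definition perspectivity (A B : {set V}) (x : V) : V :=
  if x \in B then x else odflt x [pick y in (B :\: A)%SET].

Lemma perspectivityP (d : nat) (A B F : {set V}) :
    #|A| = d.+1 -> #|B| = d.+1 -> F \subset A -> F \subset B -> #|F| = d ->
  [/\ {in F, perspectivity A B =1 id}, {in A &, injective (perspectivity A B)}
    & (perspectivity A B @: A)%SET = B].
Proof.
move=> cA cB FA FB cF.
have cD (C D : {set V}) : #|C| = d.+1 -> F \subset C -> F \subset D ->
    (#|C :\: D| <= 1)%N.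
  move=> cC FC FD; rewrite -(leq_add2l d) -{1}cF addn1 -cC.
  rewrite -(cardsID F C) (finset.setIidPr FC) leq_add2l.
  by apply/subset_leq_card/finset.setDS.
have cDE : #|A :\: B| = #|B :\: A|.
  apply/eqP; rewrite -(eqn_add2l #|A :&: B|) cardsID.
  by rewrite finset.setIC cardsID cA cB.
have pE x : x \in A -> x \notin B -> perspectivity A B x \in (B :\: A)%SET.
  move=> xA xB; rewrite /perspectivity (negbTE xB); case: pickP => //= B0.
  have : (0 < #|B :\: A|)%N.
    by rewrite -cDE card_gt0; apply/set0Pn; exists x; rewrite inE xB.
  by rewrite card_gt0 => /set0Pn[y]; rewrite B0.
have pB x : x \in B -> perspectivity A B x = x by rewrite /perspectivity => ->.
have inj : {in A &, injective (perspectivity A B)}.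
  move=> x y xA yA; case: (boolP (x \in B)) => xB;
    case: (boolP (y \in B)) => yB.
  - by rewrite !pB.
  - by move: (pE y yA yB); rewrite (pB x) // => + xp; rewrite -xp inE xA.
  - by move: (pE x xA xB); rewrite (pB y) // => + yp; rewrite yp inE yA.
  - move=> _; have /card_le1_eqP := cD A B cA FA FB.
    by apply; rewrite inE ?xB ?yB.
split=> //; first by move=> x xF; apply: pB; exact: (fintype.subsetP FB _ xF).
apply/eqP; rewrite eqEcard card_in_imset // cA cB leqnn andbT.
apply/fintype.subsetP => _ /imsetP[x xA ->]; case: (boolP (x \in B)) => xB.
  by rewrite pB.
by have := pE x xA xB; rewrite inE => /andP[].
Qed.

Fixpoint projectivity (A : {set V}) (w : seq {set V}) (x : V) : V :=
  if w is B :: w' then projectivity B w' (perspectivity A B x) else x.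

(* Permutations of s are encoded as permutations of V supported in s. *)
Definition projectivities (K : simplicial_complex V) (d : nat) (s : {set V}) :
    {set {perm V}} :=
  finset (fun g : {perm V} => perm_on s g &&
    `[< exists w : seq {set V},
          [/\ all (is_simplex K d) (s :: w), path (adjacent d) s w,
              last s w = s & {in s, g =1 projectivity s w}] >]).

Definition Phi_complex (K : simplicial_complex V) (d : nat)
    (omega : {perm V}) (s : {set V}) : Prop :=
  [/\ pure K d, simplicial_map K K omega, involutive omega,
      is_simplex K d s /\ (omega @: s)%SET = s
    & restr_perm s omega \in projectivities K d s /\
      restr_perm s omega != 1%g].

End Projectivities.

Local Open Scope classical_set_scope.

Definition unit_sphere (R : realType) (m : nat) : set 'rV[R]_m.+1 :=
  [set x | \sum_i x ord0 i ^+ 2 = 1].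
Arguments unit_sphere : clear implicits.

(* Coind_{Z_2}(X) >= m for the subspace X of T with involution nu; the values
   of f outside the sphere are irrelevant. *)
Definition coind_ge (R : realType) (T : topologicalType) (X : set T)
    (nu : T -> T) (m : nat) : Prop :=
  exists f : 'rV[R]_m.+1 -> T,
    [/\ {within unit_sphere R m, continuous f},
        (forall x, unit_sphere R m x -> X (f x))
      & (forall x, unit_sphere R m x -> f (- x) = nu (f x))].
Arguments coind_ge R {T} X nu m.

Section HomComplex.
Variables (R : realType) (V W : finType).

(* The geometric simplex with vertex set S, in barycentric coordinates. *)
Definition geom_simplex (S : {set W}) : set {ptws W -> R} :=
  [set p | [/\ forall w, 0 <= p w, \sum_w p w = 1
             & forall w, w \notin S -> p w = 0]].

Definition hom_index (K : simplicial_complex V) (L : simplicial_complex W)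
    (eta : V -> {set W}) : Prop :=
  [/\ forall v, eta v != finset.set0,
      forall u v, u != v -> [set u; v]%SET \in simplices K ->
        (eta u :&: eta v)%SET = finset.set0
    & forall (s : {set V}) (c : V -> W), s \in simplices K ->
        {in s, forall v, c v \in eta v} -> (c @: s)%SET \in simplices L].

Definition hom_complex (K : simplicial_complex V) (L : simplicial_complex W) :
    set {ptws V -> {ptws W -> R}} :=
  [set p | exists2 eta, hom_index K L eta & forall v, geom_simplex (eta v) (p v)].

End HomComplex.
Arguments hom_complex R {V W} K L.

Definition hom_map (R : realType) (V V' W : finType) (f : V -> V')
    (p : {ptws V' -> {ptws W -> R}}) : {ptws V -> {ptws W -> R}} :=
  fun v => p (f v).

Lemma hom_map_sub (R : realType) (V V' W : finType) (K : simplicial_complex V)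
    (K' : simplicial_complex V') (L : simplicial_complex W) (f : V -> V') :
  simplicial_map K K' f -> nondegenerate K f ->
  forall p, hom_complex R K' L p -> hom_complex R K L (hom_map f p).
Proof.
move=> fs fn p [eta [eta0 eta1 eta2] pe]; exists (eta \o f); last first.
  by move=> v; exact: pe.
split=> [v|u v uv uvK|s c sK cs]; first exact: eta0.
- apply: eta1.
    by apply: contra_neq uv => /(fn _ uvK); apply; rewrite !inE eqxx ?orbT.
  by have := fs _ uvK; rewrite imsetU1 imset_set1.
- have [v0 v0s] : exists v0, v0 \in s by apply/set0Pn/(complex_neq0 sK).
  pose c' w := c (odflt v0 [pick v in s | f v == w]).
  have c'E v : v \in s -> c' (f v) = c v.
    move=> vs; rewrite /c'; case: pickP => [u /andP[us /eqP fu]|/(_ v)] /=.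
      by congr c; apply: (fn _ sK).
    by rewrite vs eqxx.
  have -> : (c @: s = c' @: (f @: s))%SET.
    rewrite -imset_comp; apply: eq_in_imset => v vs.
    by rewrite /= c'E.
  apply: eta2; first exact: fs.
  by move=> _ /imsetP[v vs ->]; rewrite c'E //; exact: cs.
Qed.

(* Main.v *)
(* A coloring of K with n <= m + d + 1 colors turns the given map into an
   equivariant map f from the m-sphere to Hom(Gamma, Delta^[n]). Restricting to
   sigma gives f_sigma : S^m -> X with X = Hom(sigma, Delta^[n]) of dimension
   n - d - 1 <= m. Moving sigma along a chain of adjacent simplices changes one
   coordinate at a time, and since the target is a full simplex the linear
   homotopy stays in X. So f_sigma is homotopic to tau o f_sigma, which is
   f_sigma composed with the antipode by equivariance. The cells of X map
   equivariantly to the vertices of the cross-polytope of dimension m (the rank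
   gives the axis, and the comparison of the least colors of two vertices
   exchanged by tau gives the sign). The degree of the resulting map is then
   odd by Ky Fan's argument, and equal to its opposite since the antipode has
   degree -1 for m even.

   Combinatorially, S^m is the boundary of a cube with a fine cubical grid, and
   the degree is a signed count of the flags of faces whose labels have the
   ranks 0, ..., m and alternating signs. *)
Require Import Defs.
From mathcomp Require Import all_boot all_order all_algebra all_fingroup.
From mathcomp Require Import all_classical all_reals all_analysis.
From mathcomp Require Import zify ring lra.

Set Implicit Arguments.
Unset Strict Implicit.
Unset Printing Implicit Defensive.

Import Order.TTheory GRing.Theory Num.Theory.
Import numFieldNormedType.Exports.

Local Open Scope ring_scope.

(** * The degree of a labelling of the cubical sphere *)

(** The terms at [p] and [h p] cancel. Involutivity is only asked on [P], because [shift] below is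
    an involution only away from the outer boundary. *)
Lemma sum_sign_involution (R : pzRingType) (T : finType) (P s : pred T)
    (h : T -> T) (G : T -> R) :
  (forall p, P p -> [/\ h (h p) = p, P (h p), s (h p) = ~~ s p & G (h p) = G p]) ->
  \sum_(p | P p) (-1) ^+ s p * G p = 0.
Proof.
move=> H; rewrite (bigID s) /=.
rewrite [X in _ + X](reindex_onto h h) /=; last first.
  by move=> p /andP[/H[]].
rewrite [X in _ + X](eq_bigl (fun p => P p && s p)); last first.
  move=> p; apply/idP/idP.
    case/andP=> /andP[Php sp] /eqP hhp.
    by have [_] := H _ Php; rewrite hhp => -> ->; rewrite (negbTE sp).
  by case/andP => Pp sp; have [-> -> -> _] := H p Pp; rewrite sp eqxx.
rewrite -big_split /=; apply: big1 => p /andP[Pp sp].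
by have [_ _ -> ->] := H _ Pp; rewrite sp /= mul1r mulN1r addNr.
Qed.

Section CubeGrid.
Variables N m : nat.

(* Faces of the cubical grid in doubled coordinates: an even entry is a grid
   point, an odd entry an open unit interval. *)
Definition cell := {ffun 'I_m.+1 -> nat}.

(* [(t, e, r)] encodes the chain of faces of the cube with lower corner [t]
   that starts at the vertex [t + e] and opens the directions in the order
   prescribed by [r]. *)
Definition flag : finType :=
  ({ffun 'I_m.+1 -> 'I_N.+1} * {ffun 'I_m.+1 -> bool} * 'S_m.+1)%type.

Implicit Types (p : flag) (i : 'I_m.+1) (c : cell) (j l : nat).

Definition corner p i : nat := p.1.1 i + p.1.2 i.

Definition face p j : cell :=
  [ffun i => if (p.2 i < j)%N then (p.1.1 i).*2.+1 else (corner p i).*2].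

Definition at_rank p j : 'I_m.+1 := (p.2^-1)%g (inord j).

Definition extremal (b : nat) := (b == 0%N) || (b == N.+1).

(** The direction of rank [m] is the only one closed in [face p m], so the chain up to rank [m] lies
    in a facet of the big cube as soon as that coordinate is extremal. *)
Definition on_boundary p := extremal (corner p (at_rank p m)).

(** The orientation of the simplex of the barycentric subdivision given by the flag: it changes when
    one direction is reversed or two ranks are transposed. *)
Definition flag_sign p : bool :=
  (p.2 : bool) (+) \big[addb/false]_i p.1.2 i.

Lemma at_rankK p j : (j <= m)%N -> p.2 (at_rank p j) = j :> nat.
Proof. by move=> jm; rewrite /at_rank permKV inordK. Qed.

Lemma rankK p i : at_rank p (p.2 i) = i.
Proof. by rewrite /at_rank inord_val permK. Qed.

Lemma corner_le p i : (corner p i <= N.+1)%N.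
Proof. by rewrite /corner; have := ltn_ord (p.1.1 i); case: (p.1.2 i) => /=; lia. Qed.

Definition toggle p i (b : 'I_N.+1) : flag :=
  ([ffun k => if k == i then b else p.1.1 k],
   [ffun k => if k == i then ~~ p.1.2 k else p.1.2 k], p.2).

Lemma toggle_sign p i b : flag_sign (toggle p i b) = ~~ flag_sign p.
Proof.
rewrite /flag_sign /= (bigD1 i) //= [in RHS](bigD1 i) //= ffunE eqxx.
rewrite (eq_bigr (fun k => p.1.2 k)); last first.
  by move=> k ki; rewrite ffunE (negbTE ki).
by case: (p.2 : bool); case: (p.1.2 i); case: (\big[_/_]_(_ | _) _).
Qed.

Definition flip p := toggle p (at_rank p 0) (p.1.1 (at_rank p 0)).

(** Passes to the neighbouring unit cube through the wall orthogonal to the direction of rank [j],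
    keeping the starting vertex. The value is meaningless if this wall is on the outer boundary. *)
Definition shift j p :=
  let i := at_rank p j in
  toggle p i (inord (if p.1.2 i then (p.1.1 i).+1 else (p.1.1 i).-1)).

Definition swap j p : flag := (p.1, p.2 * tperm (inord j.-1) (inord j))%g.

(** The other flag of the same unit cube whose chain differs only in its member of index [j]: the
    vertex slides along the first edge, or two consecutive directions open in the other order. *)
Definition move_face j p := if j is 0 then flip p else swap j p.

Lemma flagP p (q : flag) : p.1.1 =1 q.1.1 -> p.1.2 =1 q.1.2 -> p.2 = q.2 -> p = q.
Proof.
case: p q => [[t e] r] [[t' e'] r'] /= /ffunP tE /ffunP eE rE.
by congr (_, _, _).
Qed.

Lemma flipK : involutive flip.
Proof.
move=> p; apply: flagP => //= i; rewrite !ffunE /=.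
all: rewrite /at_rank /=; case: eqP => // ->; rewrite ?eqxx ?negbK //.
Qed.

Lemma swapK j : (0 < j <= m)%N -> involutive (swap j).
Proof. by move=> jm p; apply: flagP => //=; rewrite -mulgA tperm2 mulg1. Qed.

Lemma move_faceK j : (j <= m)%N -> involutive (move_face j).
Proof. by case: j => [_|j jm]; [exact: flipK|exact: swapK]. Qed.

Lemma move_face_sign j p : (j <= m)%N ->
  flag_sign (move_face j p) = ~~ flag_sign p.
Proof.
case: j => [_|j jm]; first exact: toggle_sign.
rewrite /flag_sign /= odd_permM odd_tperm.
suff -> : inord j != inord j.+1 :> 'I_m.+1.
  by rewrite addbT addNb.
by apply/eqP => /(congr1 val) /=; rewrite !inordK; lia.
Qed.

Lemma move_face_rank j p i : (j <= m)%N ->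
  (j <= p.2 i)%N && ((p.2 i != j :> nat) || (j == 0%N)) || (p.2 i < j.-1)%N ->
  (move_face j p).2 i = p.2 i.
Proof.
case: j => [//|j] jm /= H; rewrite permM tpermD //.
all: by apply/eqP => /(congr1 val) /=; rewrite inordK; lia.
Qed.

Lemma move_face_corner j p i :
  (0 < j)%N || (p.2 i != 0 :> nat) -> corner (move_face j p) i = corner p i.
Proof.
case: j => [|//] /= H; rewrite /corner /= !ffunE.
case: eqP => // iE; move: H.
by rewrite iE at_rankK.
Qed.

Lemma swap_rank_lt j p i l : (0 < j <= m)%N -> l != j ->
  ((swap j p).2 i < l)%N = (p.2 i < l)%N.
Proof.
move=> jm lj; rewrite /swap /= permM.
case: tpermP => [->|->|//]; rewrite !inordK; lia.
Qed.

Lemma move_face_face j p l : (j <= m)%N -> l != j ->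
  face (move_face j p) l = face p l.
Proof.
move=> jm lj; apply/ffunP => i; rewrite !ffunE.
case: j jm lj => [|j] jm lj; last first.
  by rewrite swap_rank_lt.
rewrite /=; case: ifP => [|il]; rewrite ?ffunE.
  by case: eqP => // ->.
rewrite -[flip p]/(move_face 0 p) move_face_corner //=; move: il; case: l lj => // l _; lia.
Qed.

Lemma shift_corner j p i : ~~ extremal (corner p (at_rank p j)) ->
  corner (shift j p) i = corner p i.
Proof.
move=> H; rewrite /corner /= !ffunE; case: eqP => // ->.
move: H; rewrite /corner /extremal; have := ltn_ord (p.1.1 (at_rank p j)).
by case: (p.1.2 _) => /= ? ?; rewrite inordK; lia.
Qed.

Lemma shiftK j p : ~~ extremal (corner p (at_rank p j)) ->
  shift j (shift j p) = p.
Proof.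
move=> H; apply: flagP => //= i; rewrite !ffunE /= /at_rank /=.
all: rewrite -/(at_rank p j); case: eqP => // ->; rewrite ?eqxx ?negbK //.
apply/val_inj; move: H; rewrite /corner /extremal ?ffunE ?eqxx.
have := ltn_ord (p.1.1 (at_rank p j)).
by case: (p.1.2 _) => /= ? ?; rewrite !inordK; lia.
Qed.

Lemma shift_face j p l : (j <= m)%N -> (l <= j)%N ->
  ~~ extremal (corner p (at_rank p j)) -> face (shift j p) l = face p l.
Proof.
move=> jm lj H; apply/ffunP => i; rewrite !ffunE shift_corner //=.
case: ifP => // pl; rewrite ?ffunE; case: eqP => // iE; exfalso.
by move: pl; rewrite iE at_rankK //; lia.
Qed.

Lemma sum_shift_eq0 (R : pzRingType) j (P : pred flag) (G : flag -> R) :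
  (forall p, P p -> [/\ ~~ extremal (corner p (at_rank p j)), P (shift j p)
    & G (shift j p) = G p]) ->
  \sum_(p | P p) (-1) ^+ flag_sign p * G p = 0.
Proof.
move=> H; apply: (@sum_sign_involution _ _ _ _ (shift j)) => p Pp.
have [ext Ps Gs] := H p Pp; split=> //; first exact: shiftK.
by rewrite toggle_sign.
Qed.

Lemma sum_move_eq0 (R : pzRingType) j (P : pred flag) (G : flag -> R) :
  (j <= m)%N ->
  (forall p, P p -> P (move_face j p) /\ G (move_face j p) = G p) ->
  \sum_(p | P p) (-1) ^+ flag_sign p * G p = 0.
Proof.
move=> jm H; apply: (@sum_sign_involution _ _ _ _ (move_face j)) => p Pp.
have [Ps Gs] := H p Pp; split=> //; first exact: move_faceK.
by rewrite move_face_sign.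
Qed.

(* The faces [face p 0, ..., face p m], p on the boundary, carry a fundamental
   cycle of the boundary of the cube; the interior flags cancel in pairs. *)
Lemma boundary_cycle (R : pzRingType) j (G : (nat -> cell) -> R) : (j <= m)%N ->
  (forall x y : nat -> cell,
     (forall l, (l <= m)%N -> l != j -> x l = y l) -> G x = G y) ->
  \sum_(p | on_boundary p) (-1) ^+ flag_sign p * G (face p) = 0.
Proof.
move=> jm HG.
(* [move_face j] pairs all flags inside each unit cube, [shift m] pairs the interior ones across a
   wall; the boundary sum is the difference of two zeros. *)
have all0 : \sum_p (-1) ^+ flag_sign p * G (face p) = 0.
  apply: (@sum_move_eq0 _ j) => // p _; split=> //.
  by apply: HG => l lm lj; rewrite move_face_face.
have int0 : \sum_(p | ~~ on_boundary p) (-1) ^+ flag_sign p * G (face p) = 0.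
  apply: (@sum_shift_eq0 _ m) => p Pp; split=> //.
    by rewrite /on_boundary shift_corner.
  by apply: HG => l lm lj; rewrite shift_face.
by move: all0; rewrite (bigID on_boundary) /= int0 addr0.
Qed.

(* A label [(k, b)] stands for the vertex [+-(k + 1)] of the cross-polytope. *)
Definition label := (nat * bool)%type.

(** Opposite vertices of the cross-polytope are incomparable, so the chains of this order are
    exactly the simplices of its boundary. *)
Definition label_le (a b : label) := (a == b) || (a.1 < b.1)%N.

(** Selects one facet of the cross-polytope; its preimages counted with sign give the degree.
    Alternating signs are chosen for the parity argument. *)
Definition alternating (q : nat -> label) : bool :=
  [forall j : 'I_m.+1, q j == (j : nat, odd j)].

Lemma alternatingE (R : comNzRingType) q :
  (alternating q)%:R = \prod_(j < m.+1) (q j == (j : nat, odd j))%:R :> R.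
Proof.
case: (boolP (alternating q)) => [/forallP H|].
  by rewrite big1 // => j _; rewrite H.
by rewrite negb_forall => /existsP[j /negbTE H]; rewrite (bigD1 j) //= H mul0r.
Qed.

(** There are [m.+2] labels and [m.+1] ranks, so two consecutive labels coincide. Only the deletion
    of one of these two can leave an alternating sequence, and both deletions leave the same one,
    with opposite signs. *)
Lemma alternating_cocycle (q : nat -> label) :
  (forall j, (j <= m)%N -> label_le (q j) (q j.+1)) ->
  (forall j, (j <= m.+1)%N -> (q j).1 <= m)%N ->
  \sum_(j < m.+2) (-1) ^+ j * (alternating (q \o bump j))%:R = 0 :> int.
Proof.
move=> qle qm.
have [k km qk] : exists2 k, (k <= m)%N & q k = q k.+1.
  have [/existsP[k /eqP ?]|] :=
    boolP [exists k : 'I_m.+1, q k == q k.+1]; first by exists k => //; rewrite -ltnS.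
  rewrite negb_exists => /forallP H; exfalso.
  have : forall j, (j <= m.+1)%N -> (j <= (q j).1)%N.
    elim=> // j IH jm; apply: leq_ltn_trans (IH _) _; first lia.
    have := qle j; have := H (inord j); rewrite inordK ?ltnS //.
    rewrite /label_le => /negbTE -> /=; exact.
  by move/(_ m.+1 (leqnn _)); have := qm m.+1 (leqnn _); lia.
have k1 : (k < m.+2)%N by lia.
have k2 : (k.+1 < m.+2)%N by lia.
rewrite (bigD1 (Ordinal k1)) //= (bigD1 (Ordinal k2)) /=; last first.
  by apply/eqP => /(congr1 val) /=; lia.
rewrite big1 ?addr0; last first.
  move=> j /andP[/eqP jk1 /eqP jk2].
  have {}jk1 : j <> k :> nat by move=> jE; apply: jk1; apply/val_inj.
  have {}jk2 : j <> k.+1 :> nat by move=> jE; apply: jk2; apply/val_inj.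
  suff /negbTE -> : ~~ alternating (q \o bump j) by rewrite mulr0.
  apply/negP => /forallP H.
  (* The position of the repeated label after the deletion of [j]; its twin follows at [a.+1], but
     the two ranks would have to differ. *)
  pose a := unbump j k.
  have a1 : (a < m.+1)%N by rewrite /a /unbump; have := ltn_ord j; lia.
  have a2 : (a.+1 < m.+1)%N by rewrite /a /unbump; have := ltn_ord j; lia.
  have := H (Ordinal a1); have := H (Ordinal a2) => /=.
  have -> : bump j a = k by rewrite /a /bump /unbump; lia.
  have -> : bump j a.+1 = k.+1 by rewrite /a /bump /unbump; lia.
  by rewrite qk => /eqP -> /eqP [] /eqP; lia.
have -> : alternating (q \o bump k.+1) = alternating (q \o bump k).
  apply: eq_forallb => j /=.
  suff -> : q (bump k.+1 j) = q (bump k j) by [].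
  have [->|jk] := eqVneq (j : nat) k; first by rewrite /bump leqnn ltnn.
  by congr q; rewrite /bump; lia.
by rewrite exprS mulN1r mulNr addrN.
Qed.

Definition degree (L : cell -> label) : int :=
  \sum_(p | on_boundary p)
    (-1) ^+ flag_sign p * (alternating (L \o face p))%:R.

(* The terms of the prism between L and L' are exchanged one level at a time. *)
Lemma degree_le (L L' : cell -> label) :
  (forall p j, on_boundary p -> (j < m)%N ->
     label_le (L (face p j)) (L (face p j.+1))) ->
  (forall p j, on_boundary p -> (j < m)%N ->
     label_le (L' (face p j)) (L' (face p j.+1))) ->
  (forall p j, on_boundary p -> (j <= m)%N ->
     label_le (L (face p j)) (L' (face p j))) ->
  (forall p j, on_boundary p -> (j <= m)%N -> (L (face p j)).1 <= m)%N ->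
  (forall p j, on_boundary p -> (j <= m)%N -> (L' (face p j)).1 <= m)%N ->
  degree L = degree L'.
Proof.
move=> Lmon L'mon LL' Lm L'm.
pose mixed l (x : nat -> cell) j := if (j < l)%N then L (x j) else L' (x j).
pose D l := \sum_(p | on_boundary p)
  (-1) ^+ flag_sign p * (alternating (mixed l (face p)))%:R : int.
suff Dl l : (l <= m.+1)%N -> D l = D 0%N.
  have <- : D m.+1 = degree L.
    apply: eq_bigr => p _; congr (_ * _%:R); congr nat_of_bool.
    by apply: eq_forallb => j /=; rewrite /mixed ltn_ord.
  by rewrite Dl //; apply: eq_bigr.
elim: l => // l IH lm; rewrite -IH; last exact: ltnW.
(* One simplex of the prism: [L] up to level [l], then [L'] from level [l] on. Deleting entry [l]
   gives [mixed l], deleting entry [l.+1] gives [mixed l.+1]. *)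
pose q (x : nat -> cell) j := if (j <= l)%N then L (x j) else L' (x j.-1).
have : \sum_(p | on_boundary p) (-1) ^+ flag_sign p *
    \sum_(j < m.+2) (-1) ^+ j * (alternating (q (face p) \o bump j))%:R
    = 0 :> int.
  apply: big1 => p bp; rewrite alternating_cocycle ?mulr0 // => j jm.
    rewrite /q; case: ltngtP => // [jl|jl|->] /=.
    - by apply: Lmon => //; lia.
    - by case: j jm jl => [|j] jm jl //=; apply: L'mon.
    - exact: LL'.
  by rewrite /q; case: (leqP j l) => jl; [apply: Lm|apply: L'm] => //; lia.
under eq_bigr do rewrite mulr_sumr.
rewrite exchange_big /=.
have l1 : (l < m.+2)%N by lia.
have l2 : (l.+1 < m.+2)%N by lia.
rewrite (bigD1 (Ordinal l1)) //= (bigD1 (Ordinal l2)) /=; last first.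
  by apply/eqP => /(congr1 val) /=; lia.
rewrite [X in _ + (_ + X)]big1 ?addr0; last first.
  move=> j /andP[/eqP jl1 /eqP jl2].
  have {}jl1 : j <> l :> nat by move=> jE; apply: jl1; apply/val_inj.
  have {}jl2 : j <> l.+1 :> nat by move=> jE; apply: jl2; apply/val_inj.
  under eq_bigr do rewrite mulrCA.
  rewrite -mulr_sumr.
  (* Any other deletion removes the only entry that reads the face of index [j'], so
     [boundary_cycle] makes its sum vanish. *)
  pose j' := if (j < l)%N then j : nat else j.-1.
  rewrite (@boundary_cycle _ j' (fun x => (alternating (q x \o bump j))%:R))
    ?mulr0 //; first by rewrite /j'; have := ltn_ord j; case: (ltnP j l); lia.
  move=> x y xy; congr (_%:R); congr nat_of_bool.
  apply: eq_forallb => i /=; congr (_ == _).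
  have := ltn_ord i; have := ltn_ord j; rewrite /q /j' /bump in xy * => jm im.
  by case: (leqP ((j <= i) + i) l) => ?; rewrite xy //;
    move: jl1 jl2; case: (ltnP j l); lia.
have E k : (k <= 1)%N -> \sum_(p | on_boundary p) (-1) ^+ flag_sign p *
    ((-1) ^+ (l + k) * (alternating (q (face p) \o bump (l + k)))%:R) =
    (-1) ^+ (l + k) * D (l + k)%N.
  move=> k1; rewrite mulr_sumr; apply: eq_bigr => p _; rewrite mulrCA.
  congr (_ * (_ * _%:R)); congr nat_of_bool; apply: eq_forallb => i /=.
  congr (_ == _); rewrite /q /mixed /bump.
  case: (leqP (l + k) i) => ik /=; last first.
    by rewrite add0n ifT //; lia.
  by rewrite ifF //; lia.
have := E 0%N isT; have := E 1%N isT; rewrite addn1 addn0 => -> ->.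
rewrite exprS mulN1r mulNr -mulrBr => /eqP.
by rewrite mulf_eq0 signr_eq0 /= subr_eq0 => /eqP.
Qed.

(** * The antipode on cells and flags *)

Definition opp_cell (c : cell) : cell := [ffun i => N.+1.*2 - c i]%N.

Definition negate (A : pred 'I_m.+1) p : flag :=
  ([ffun i => if A i then rev_ord (p.1.1 i) else p.1.1 i],
   [ffun i => if A i then ~~ p.1.2 i else p.1.2 i], p.2).

Lemma negateK A : involutive (negate A).
Proof.
move=> p; apply: flagP => //= i; rewrite !ffunE /=; case: (A i) => //.
  exact: rev_ordK.
exact: negbK.
Qed.

Lemma negate_corner A p i :
  corner (negate A p) i = if A i then (N.+1 - corner p i)%N else corner p i.
Proof.
rewrite /corner !ffunE; case: ifP => // _ /=; have := ltn_ord (p.1.1 i).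
by case: (p.1.2 i) => /=; lia.
Qed.

Lemma negate_face A p j i :
  face (negate A p) j i = if A i then (N.+1.*2 - face p j i)%N else face p j i.
Proof.
rewrite !ffunE negate_corner /=; have := ltn_ord (p.1.1 i).
have := corner_le p i; case: (A i); case: ifP => //= _; lia.
Qed.

Lemma face_negate p j : face (negate predT p) j = opp_cell (face p j).
Proof. by apply/ffunP => i; rewrite negate_face [RHS]ffunE. Qed.

Lemma extremal_opp b : (b <= N.+1)%N -> extremal (N.+1 - b) = extremal b.
Proof. by rewrite /extremal; lia. Qed.

Lemma on_boundary_negate p : on_boundary (negate predT p) = on_boundary p.
Proof. by rewrite /on_boundary negate_corner extremal_opp // corner_le. Qed.

Lemma flag_sign_negate p :
  flag_sign (negate predT p) = flag_sign p (+) odd m.+1.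
Proof.
rewrite /flag_sign /= -addbA; congr (_ (+) _).
under eq_bigr => i _ do rewrite ffunE /= -addTb.
rewrite big_split /= addbC; congr (_ (+) _).
by rewrite big_const_ord -[~~ odd m]/(odd m.+1); elim: m.+1 => //= k ->.
Qed.

(** The antipode is a product of [m.+1] reflections, each reversing the sign of every flag. *)
Lemma degree_opp (L : cell -> label) :
  degree (L \o opp_cell) = (-1) ^+ m.+1 * degree L.
Proof.
rewrite /degree mulr_sumr (reindex_inj (inv_inj (negateK predT))) /=.
apply: eq_big => [p|p _]; first exact: on_boundary_negate.
rewrite flag_sign_negate signr_addb signr_odd mulrA; congr (_ * _%:R).
  exact: mulrC.
congr nat_of_bool; apply: eq_forallb => j /=; congr (L _ == _).
by rewrite -face_negate negateK.
Qed.

Definition cell_extremal c i := (c i == 0%N) || (c i == N.+1.*2).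

(** * Alternating sign sequences modulo 2 *)

Section Parity.
Variable S : cell -> bool.
Hypothesis S_odd : forall p j i, cell_extremal (face p j) i ->
  S (opp_cell (face p j)) = ~~ S (face p j).
Hypothesis S_local : forall c c' i, cell_extremal c i ->
  (forall l : 'I_m.+1, (l <= i)%N -> c l = c' l) -> S c = S c'.

Definition alternates (b : bool) (v : nat -> bool) n : 'F_2 :=
  \prod_(j < n) (v j == b (+) odd j)%:R.

Lemma F2_addxx (x : 'F_2) : x + x = 0.
Proof. exact/addrr_pchar2/pchar_Fp. Qed.

Lemma F2_sign (b : bool) (x : 'F_2) : (-1) ^+ b * x = x.
Proof.
by case: b; rewrite ?mul1r // mulN1r oppr_pchar2 //; apply: pchar_Fp.
Qed.

Lemma alternates_recl b v n : alternates b v n.+1 =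
  (v 0%N == b)%:R * alternates (~~ b) (v \o succn) n.
Proof.
rewrite /alternates big_ord_recl addbF; congr (_ * _).
by apply: eq_bigr => j _ /=; rewrite addbN addNb.
Qed.

(** A fully alternating sequence has one good deletion, the last or the first entry according to its
    starting sign. Any other sequence has none, or two that cancel around an equal adjacent pair. *)
Lemma alternates_coboundary b v n :
  \sum_(j < n.+1) alternates b (v \o bump j) n =
  alternates b v n.+1 + alternates (~~ b) v n.+1.
Proof.
elim: n b v => [|n IH] b v.
  rewrite big_ord1 !alternates_recl /alternates !big_ord0 !mulr1.
  by case: (v 0%N); case: b; rewrite ?addr0 ?add0r.
rewrite big_ord_recl.
have -> : alternates b (v \o bump 0) n.+1 = alternates b (v \o succn) n.+1.
  by [].
rewrite (eq_bigr (fun j : 'I_n.+1 =>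
    (v 0%N == b)%:R * alternates (~~ b) ((v \o succn) \o bump j) n)); last first.
  move=> j _; rewrite alternates_recl; congr (_ * _).
  by apply: eq_bigr => i _; congr (nat_of_bool (v _ == _))%:R; exact: bumpS.
rewrite -mulr_sumr IH negbK !(alternates_recl _ v) negbK.
set x := alternates b _ _; set y := alternates (~~ b) _ _.
case: (v 0%N); case: b @x @y => x y /=; rewrite ?mul1r ?mul0r ?addr0 ?add0r //.
all: by rewrite addrC -addrA F2_addxx addr0.
Qed.

(** The coordinates from [k] on stay at 0 and open last. By [S_local] they are irrelevant once an
    earlier coordinate is extremal, so the boundary of this subcube serves as an equator although
    the antipode does not preserve it. *)
Definition standard_from k p :=
  [forall i : 'I_m.+1, (k <= i)%N ==> ((p.2 i == i) && (corner p i == 0%N))].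

(* The maximal chains of the sphere spanned by the coordinates up to k. *)
Definition subsphere_flag k p :=
  standard_from k.+1 p && extremal (corner p (at_rank p k)).

Definition parity k : 'F_2 :=
  \sum_(p | subsphere_flag k p) alternates false (S \o face p) k.+1.

Lemma standard_fromP k p i : standard_from k p -> (k <= i)%N ->
  p.2 i = i /\ corner p i = 0%N.
Proof. by move=> /forallP /(_ i) /implyP H /H /andP[/eqP -> /eqP ->]. Qed.

Lemma face_extremal p j i : (j <= p.2 i)%N -> extremal (corner p i) ->
  cell_extremal (face p j) i.
Proof.
move=> ji; rewrite /extremal /cell_extremal ffunE ltnNge ji /=.
by case/orP => /eqP ->; rewrite ?eqxx ?orbT.
Qed.

(** The extremal coordinate [i] precedes [k], so opening direction [k] does not affect [S], and two
    consecutive signs agree. *)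
Lemma subsphere_flag_degenerate (k : 'I_m.+1) p :
  subsphere_flag k p -> p.2 k != k ->
  alternates false (S \o face p) k.+1 = 0.
Proof.
move=> /andP[std ext] pk.
set i := at_rank p k in ext.
have pi : p.2 i = k :> nat by apply: at_rankK; rewrite -ltnS.
have ik : (i < k)%N.
  rewrite ltnNge; apply/negP => ki; move: pi pk.
  have [iE|] := eqVneq i k; first by rewrite -iE => /val_inj ->; rewrite eqxx.
  rewrite -val_eqE /= => /eqP iNk.
  by case: (standard_fromP std (i := i)) => [|-> _ /= E]; lia.
have lk : (p.2 k < k)%N.
  rewrite ltn_neqAle; move: (pk); rewrite -val_eqE /= => -> /=.
  rewrite leqNgt; apply/negP => kp.
  have [E _] := standard_fromP std kp.
  by move/perm_inj: E => E; rewrite E eqxx in pk.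
have SE : S (face p (p.2 k)) = S (face p (p.2 k).+1).
  apply: (@S_local _ _ i); first by apply: face_extremal; rewrite ?pi // ltnW.
  move=> l li; rewrite !ffunE ltnS.
  have : p.2 l != p.2 k by apply/eqP => /perm_inj lE; move: li; rewrite lE; lia.
  by rewrite -val_eqE /= ltn_neqAle => /negbTE -> /=; case: ltngtP.
have l1 : (p.2 k < k.+1)%N by lia.
have l2 : ((p.2 k).+1 < k.+1)%N by lia.
rewrite /alternates (bigD1 (Ordinal l1)) //= (bigD1 (Ordinal l2)) /=; last first.
  by apply/eqP => /(congr1 val) /=; lia.
by rewrite -SE; case: (S _); case: (odd _); rewrite ?mul0r ?mulr0.
Qed.

(** Only the flags on the two facets orthogonal to [k] remain. The lower facet is [standard_from k];
    reflecting the coordinates up to [k] carries the upper facet onto it and reverses all signs. *)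
Lemma parity_fold (k : 'I_m.+1) :
  parity k = \sum_(p | standard_from k p)
    (alternates false (S \o face p) k.+1 + alternates true (S \o face p) k.+1).
Proof.
rewrite /parity (bigID (fun p => p.2 k == k)) /= [X in _ + X]big1 ?addr0;
  last by move=> p /andP[]; apply: subsphere_flag_degenerate.
pose Q p := [&& standard_from k.+1 p, p.2 k == k & extremal (corner p k)].
have QE p : subsphere_flag k p && (p.2 k == k) = Q p.
  rewrite /subsphere_flag /Q -andbA; congr (_ && _); rewrite andbC.
  by case: eqP => //= pk; rewrite -{1}pk rankK.
have stdE p : standard_from k p = Q p && (corner p k == 0%N).
  apply/idP/idP => [std|/andP[/and3P[std pk _] ck]].
    have [pk ck] := standard_fromP std (leqnn k).
    rewrite /Q pk ck /extremal !eqxx !andbT; apply/forallP => i.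
    apply/implyP => ki; have [-> ->] := standard_fromP std (ltnW ki).
    by rewrite !eqxx.
  apply/forallP => i; apply/implyP; rewrite leq_eqVlt => /orP[/eqP/val_inj <-|].
    by rewrite pk.
  by move=> /(standard_fromP std)[-> ->]; rewrite !eqxx.
rewrite (eq_bigl _ _ QE) (bigID (fun p => corner p k == 0%N)) /= big_split /=.
rewrite -(eq_bigl _ _ stdE); congr (_ + _).
pose A : pred 'I_m.+1 := fun i => (i <= k)%N.
have QA p : Q (negate A p) && (corner (negate A p) k != 0%N) = standard_from k p.
  rewrite stdE /Q !negate_corner /A leqnn /=.
  have -> : standard_from k.+1 (negate A p) = standard_from k.+1 p.
    apply: eq_forallb => i; rewrite negate_corner /A.
    by case: ltnP => //= ki; rewrite leqNgt ki.
  case: (standard_from k.+1 p) => //=; case: eqP => //= _.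
  by have := corner_le p k; rewrite /extremal; lia.
rewrite (reindex_inj (inv_inj (negateK A))) /=.
apply: eq_big => p; first exact: QA.
rewrite QA stdE => /andP[/and3P[_ pk ext] _]; apply: eq_bigr => j _.
have fext : cell_extremal (face p j) k.
  by apply: face_extremal => //; rewrite (eqP pk) -ltnS.
congr (nat_of_bool _)%:R => /=.
suff -> : S (face (negate A p) j) = ~~ S (face p j).
  by case: (S _); case: odd.
(* The reflection agrees with the full antipode up to the extremal coordinate [k], and [S_local]
   discards the rest. *)
rewrite -(S_odd fext); symmetry; apply: (@S_local _ _ k).
  move: fext (corner_le p k); rewrite /cell_extremal /opp_cell !ffunE.
  by case: ifP => _; lia.
by move=> l lk; rewrite negate_face /A lk [LHS]ffunE.
Qed.

(** The two starting signs combine into a sum over deletions. A deletion at [j < k] cancels under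
    [move_face j], which leaves the deletion of the last face. *)
Lemma parity_coboundary (k : 'I_m.+1) :
  parity k = \sum_(p | standard_from k p) alternates false (S \o face p) k.
Proof.
rewrite parity_fold.
under eq_bigr do rewrite -(alternates_coboundary false).
rewrite exchange_big /= big_ord_recr /= big1 ?add0r.
  apply: eq_bigr => p _; apply: eq_bigr => i _ /=.
  by rewrite /bump leqNgt ltn_ord.
move=> j _.
(* Signs are free in characteristic 2; inserting them makes the signed cancellation applicable. *)
under eq_bigr => p _ do rewrite -(F2_sign (flag_sign p) (alternates _ _ _)).
apply: (@sum_move_eq0 _ j) => [|p std].
  by have := ltn_ord j; have := ltn_ord k; lia.
have jm : (j <= m)%N by have := ltn_ord j; have := ltn_ord k; lia.
split; last first.
  apply: eq_bigr => i _ /=; rewrite move_face_face // eq_sym neq_bump //.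
apply/forallP => i; apply/implyP => ki.
have [pi ci] := standard_fromP std ki.
have ji : (j < i)%N by apply: leq_trans ki.
rewrite move_face_rank ?move_face_corner ?pi ?ci ?eqxx //; lia.
Qed.

(** The flags of [standard_from k.+1] fill a disc: those with an interior wall at rank [k] cancel
    under [shift k], and the others form the bounding [k]-sphere. *)
Lemma parity_step (k : nat) : (k.+1 < m.+1)%N -> parity k.+1 = parity k.
Proof.
move=> km; rewrite -[k.+1]/(val (Ordinal km)) parity_coboundary /=.
rewrite (bigID (fun p => extremal (corner p (at_rank p k)))) /=.
rewrite [X in _ + X](_ : _ = 0) ?addr0 //.
under eq_bigr => p _ do rewrite -(F2_sign (flag_sign p) (alternates _ _ _)).
apply: (@sum_shift_eq0 _ k) => p /andP[std ext]; split=> //.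
  rewrite shift_corner // ext andbT; apply/forallP => i.
  by rewrite shift_corner //; move/forallP: std => /(_ i).
by apply: eq_bigr => i _ /=; rewrite shift_face //; have := ltn_ord i; lia.
Qed.

Lemma parity0 : parity 0 = 1.
Proof.
rewrite -[0%N]/(val (@ord0 m)) parity_coboundary /=.
pose p0 : flag := ([ffun => ord0], [ffun => false], 1%g).
rewrite (big_pred1 p0); first by rewrite /alternates big_ord0.
move=> p; apply/idP/eqP => [std|->].
  apply: flagP => [i|i|]; try (apply/permP => i);
    have [pi ci] := standard_fromP std (leq0n i); rewrite /= ?ffunE.
  - by apply/val_inj; move: ci; rewrite /corner /=; lia.
  - by move: ci; rewrite /corner; case: (p.1.2 i) => //; lia.
  - by rewrite perm1.
by apply/forallP => i; rewrite /corner /= !ffunE perm1 !eqxx.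
Qed.

Lemma parity1 k : (k <= m)%N -> parity k = 1.
Proof. by elim: k => [_|k IH km]; rewrite ?parity0 // parity_step // IH // ltnW. Qed.

End Parity.

(* Ky Fan's argument: modulo 2 the degree counts the alternating chains, and
   this count does not change when passing to the equator. *)
Lemma degree_odd (L : cell -> label) :
  (forall p j i, cell_extremal (face p j) i ->
     (L (opp_cell (face p j))).2 = ~~ (L (face p j)).2) ->
  (forall c c' i, cell_extremal c i ->
     (forall l : 'I_m.+1, (l <= i)%N -> c l = c' l) -> L c = L c') ->
  (forall p j, on_boundary p -> (j < m)%N ->
     label_le (L (face p j)) (L (face p j.+1))) ->
  (forall p j, on_boundary p -> (j <= m)%N -> (L (face p j)).1 <= m)%N ->
  (degree L)%:~R = 1 :> 'F_2.
Proof.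
move=> Lodd Lloc Lmon Lm.
pose S c := (L c).2.
have pS : parity S m = 1.
  by apply: parity1 => // c c' i ce cc'; rewrite /S (Lloc _ _ _ ce cc').
rewrite -[RHS]pS /degree (rmorph_sum ( *~%R (1 : 'F_2))) /=; apply: eq_big => [p|p bp].
  rewrite /subsphere_flag /on_boundary; case: extremal; rewrite ?andbF ?andbT //.
  by apply/esym/forallP => i; rewrite leqNgt ltnS -ltnS ltn_ord.
have aE (b : bool) : (b%:R : int)%:~R = b%:R :> 'F_2 by case: b.
rewrite intrM intr_sign F2_sign aE alternatingE /alternates.
case: (boolP [forall j : 'I_m.+1, S (face p j) == odd j]) => [/forallP alt|].
  apply: eq_bigr => j _ /=; rewrite (eqP (alt j)) eqxx.
  suff -> : L (face p j) = (j : nat, odd j) by rewrite eqxx.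
  (* Alternating signs rule out equal consecutive labels, so the [m.+1] ranks increase strictly
     inside 0, ..., m and the rank at [j] must be [j]. *)
  have rlt a : (a < m)%N -> ((L (face p a)).1 < (L (face p a.+1)).1)%N.
    move=> am; have /orP[/eqP E|//] := Lmon p a bp am.
    have a1 : (a < m.+1)%N by lia.
    have a2 : (a.+1 < m.+1)%N by lia.
    have := alt (Ordinal a1); have := alt (Ordinal a2).
    by rewrite /= /S E /= => /eqP -> ; case: odd.
  have rge a : (a <= m)%N -> (a <= (L (face p a)).1)%N.
    by elim: a => // a IH am; have := IH (ltnW am); have := rlt a am; lia.
  have rle a : (a <= m)%N -> ((L (face p (m - a))).1 <= m - a)%N.
    elim: a => [_|a IH am]; first by rewrite subn0; exact: Lm.
    have := rlt (m - a.+1)%N; have -> : (m - a.+1).+1 = (m - a)%N by lia.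
    by have := IH (ltnW am); lia.
  apply/eqP; rewrite [L _]surjective_pairing xpair_eqE; apply/andP; split; last first.
    exact: (alt j).
  have jm : (j <= m)%N by rewrite -ltnS.
  rewrite eqn_leq rge // andbT -{2}(subKn jm) -{1}(subKn jm); apply: rle; lia.
rewrite negb_forall => /existsP[j jN].
rewrite (bigD1 j) //= [RHS](bigD1 j) //= (negbTE jN) !mul0r.
case: eqP => [E|]; last by rewrite mul0r.
by move: jN; rewrite /S E eqxx.
Qed.

End CubeGrid.

(** * Grids on the round sphere *)

Section SphereApproximation.
Local Open Scope classical_set_scope.

(** The Heine-Cantor argument, through the near-covering form of compactness, for finitely many
    functions at once and relative to [A]. *)
Lemma compact_unif_within (R : realType) (U : pseudoMetricType R) (J : finType)
    (A : set U) (g : J -> U -> R) :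
  compact A -> (forall j x, A x -> g j y @[y --> within A (nbhs x)] --> g j x) ->
  forall e : R, 0 < e -> exists2 r : R, 0 < r & forall x y j,
    A x -> A y -> ball x r y -> `|g j x - g j y| < e.
Proof.
move=> /compact_near_coveringP/near_covering_withinP Acpt gc e e0.
pose P (r : R) x := forall y j, A y -> ball x r y -> `|g j x - g j y| < e.
have : \forall r \near 0^'+, A `<=` P r.
  apply: Acpt => x Ax.
  have : \forall y \near x, A y -> forall j, `|g j x - g j y| < e / 2.
    have H : \forall y \near within A (nbhs x), forall j, `|g j x - g j y| < e / 2.
      apply: filter_forall => j; have /cvgrPdist_lt := gc j x Ax.
      by apply; rewrite divr_gt0.
    exact: H.
  move=> /nbhs_ballP[s /= s0 sP].
  exists (ball x (s / 2), [set r | 0 < r < s / 2]).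
    split=> /=; first by apply: nbhsx_ballx; rewrite divr_gt0.
    near=> r; apply/andP; split; near: r.
      exact: nbhs_right_gt.
    by apply: nbhs_right_lt; rewrite divr_gt0.
  move=> [z r] /= [xz /andP[r0 rs]] Az y j Ay zy.
  have xy : ball x s y.
    by rewrite (splitr s); apply: ball_triangle xz _; apply: le_ball zy; exact: ltW.
  have xz' : ball x s z by apply: le_ball xz; lra.
  have := sP _ xy Ay j; have := sP _ xz' Az j.
  have := ler_distD (g j x) (g j z) (g j y).
  rewrite (distrC (g j z) (g j x)); lra.
move=> Pnear; near ((0 : R)^'+) => r.
exists r => [|x y j Ax Ay xy]; first by near: r; exact: nbhs_right_gt.
have AP : A `<=` P r by near: r.
exact: AP Ax y j Ay xy.
Unshelve. all: by end_near. Qed.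

Section SphereGrid.
Variables (R : realType) (m : nat).
Implicit Types (x y : 'rV[R]_m.+1).

(* A map from the boundary of the cube onto the l^1-sphere which only depends
   on the coordinates of y up to the first one of absolute value 1. *)
Definition spread y : 'rV[R]_m.+1 :=
  \row_i ((\prod_(l < m.+1 | (l < i)%N) (1 - `|y ord0 l|)) * y ord0 i).

Definition normalize y : 'rV[R]_m.+1 :=
  (Num.sqrt (\sum_i y ord0 i ^+ 2))^-1 *: y.

Definition cube_boundary : set 'rV[R]_m.+1 :=
  [set y | (forall i, `|y ord0 i| <= 1) /\ exists i, `|y ord0 i| = 1].

Lemma spread_local y y' i : `|y ord0 i| = 1 ->
  (forall l : 'I_m.+1, (l <= i)%N -> y ord0 l = y' ord0 l) ->
  spread y = spread y'.
Proof.
move=> yi yy'; apply/rowP => k; rewrite !mxE.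
case: (leqP k i) => ki.
  rewrite yy' //; congr (_ * _); apply: eq_bigr => l lk.
  by rewrite yy' //; apply: leq_trans ki; exact: ltnW.
by rewrite (bigD1 i) //= [in RHS](bigD1 i) //= -yy' // yi subrr !mul0r.
Qed.

Lemma spreadN y : spread (- y) = - spread y.
Proof.
apply/rowP => k; rewrite !mxE mulrN; congr (- (_ * _)).
by apply: eq_bigr => l _; rewrite mxE normrN.
Qed.

Lemma normalizeN y : normalize (- y) = - normalize y.
Proof.
rewrite /normalize scalerN; congr (- ((Num.sqrt _)^-1 *: _)).
by apply: eq_bigr => i _; rewrite mxE sqrrN.
Qed.

(** At the first coordinate of absolute value 1 no earlier factor vanishes, so this entry of
    [spread y] is nonzero. *)
Lemma spread_gt0 y : cube_boundary y -> 0 < \sum_i spread y ord0 i ^+ 2.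
Proof.
move=> [_ [i0 /eqP yi0]].
case: (@arg_minnP _ i0 (fun i => `|y ord0 i| == 1) (@nat_of_ord _) yi0) => i yi imin.
rewrite (bigD1 i) //= ltr_pwDl //.
  rewrite exprn_even_gt0 //= mxE mulf_neq0 //; last first.
    by rewrite -normr_eq0 (eqP yi) oner_eq0.
  apply/prodf_neq0 => l li; rewrite subr_eq0 eq_sym.
  by apply/negP => /imin; rewrite leqNgt li.
by apply: sumr_ge0 => l _; exact: sqr_ge0.
Qed.

Lemma normalize_sphere y : 0 < \sum_i y ord0 i ^+ 2 ->
  unit_sphere R m (normalize y).
Proof.
move=> y0; rewrite /unit_sphere /=.
under eq_bigr do rewrite mxE exprMn exprVn.
by rewrite -mulr_sumr sqr_sqrtr ?ltW // mulVf // gt_eqF.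
Qed.

Lemma rV_continuous (T : topologicalType) (h : T -> 'rV[R]_m.+1) (t : T) :
  (forall i, {for t, continuous (fun s => h s ord0 i)}) -> {for t, continuous h}.
Proof.
move=> hc; apply/cvg_ballP => e e0.
have : \forall s \near t, forall i, ball (h t ord0 i) e (h s ord0 i).
  apply: filter_forall => i; have /cvg_ballP := hc i; exact.
apply: filterS => s H; split=> // a b.
by rewrite (ord1 a).
Qed.

Lemma norm_coord_continuous i : continuous (fun y : 'rV[R]_m.+1 => `|y ord0 i|).
Proof.
move=> y; apply: (@continuous_comp _ _ _ (fun s : 'rV[R]_m.+1 => s ord0 i)).
  exact: coord_continuous.
exact: norm_continuous.
Qed.

Lemma spread_continuous : continuous spread.
Proof.
move=> y; apply: rV_continuous => i.
rewrite (_ : (fun s => _) = (fun s : 'rV[R]_m.+1 =>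
  (\prod_(l < m.+1 | (l < i)%N) (1 - `|s ord0 l|)) * s ord0 i)); last first.
  by apply/funext => s; rewrite mxE.
apply: continuousM; last exact: coord_continuous.
suff : continuous (fun s : 'rV[R]_m.+1 =>
    \prod_(l < m.+1 | (l < i)%N) (1 - `|s ord0 l|)) by apply.
apply: continuous_big => [|l _ s]; first exact: mul_continuous.
apply: (@continuous_comp _ _ _ (fun s : 'rV[R]_m.+1 => s ord0 l)
  (fun r => 1 - `|r|)); first exact: coord_continuous.
by apply: cvgB; [exact: cvg_cst|exact: norm_continuous].
Qed.

Lemma normalize_continuous y : 0 < \sum_i y ord0 i ^+ 2 ->
  {for y, continuous normalize}.
Proof.
move=> y0; apply: rV_continuous => i.
rewrite (_ : (fun s => _) = (fun s : 'rV[R]_m.+1 =>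
  (Num.sqrt (\sum_i s ord0 i ^+ 2))^-1 * s ord0 i)); last first.
  by apply/funext => s; rewrite mxE.
apply: continuousM; last exact: coord_continuous.
apply: continuousV; first by rewrite gt_eqF // sqrtr_gt0.
apply: (@continuous_comp _ _ _ (fun s : 'rV[R]_m.+1 => \sum_i s ord0 i ^+ 2));
  last exact: sqrt_continuous.
suff : continuous (fun s : 'rV[R]_m.+1 => \sum_i s ord0 i ^+ 2) by apply.
apply: continuous_big => [|l _ s]; first exact: add_continuous.
apply: (@continuous_comp _ _ _ (fun s : 'rV[R]_m.+1 => s ord0 l)
  (fun r => r ^+ 2)); first exact: coord_continuous.
exact: exprn_continuous.
Qed.

Lemma cube_boundary_compact : compact cube_boundary.
Proof.
apply: bounded_closed_compact.
  exists 1; split; first exact: num_real.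
  move=> M M1 y [yle _]; rewrite /= /Num.norm /= mx_normrE.
  apply: bigmax_le => [|[a b] _ /=]; first lra.
  by rewrite (ord1 a); apply: le_trans (yle b) _; exact: ltW.
rewrite (_ : cube_boundary =
  (\bigcap_i [set y | `|y ord0 i| <= 1]) `&`
  (\bigcup_(i in [set: 'I_m.+1]) [set y | `|y ord0 i| = 1])); last first.
  apply/seteqP; split=> y /= [y1 y2]; split.
  - by move=> i _; exact: y1.
  - by case: y2 => i yi; exists i.
  - by move=> i; exact: (y1 i I).
  - by case: y2 => i _ yi; exists i.
apply: closedI.
  apply: closed_bigI => i _.
  apply: (@preimage_closed _ _ (fun y : 'rV[R]_m.+1 => `|y ord0 i|) [set r | r <= 1]).
    by move=> y _; exact: norm_coord_continuous.
  exact: closed_le.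
apply: closed_bigcup => [|i _]; first exact: finite_finset.
apply: (@preimage_closed _ _ (fun y : 'rV[R]_m.+1 => `|y ord0 i|) [set r | r = 1]).
  by move=> y _; exact: norm_coord_continuous.
exact: closed_eq.
Qed.

Variable N : nat.

Definition grid_point (c : {ffun 'I_m.+1 -> nat}) : 'rV[R]_m.+1 :=
  \row_i ((c i)%:R / N.+1%:R - 1).

Definition sphere_point c : 'rV[R]_m.+1 := normalize (spread (grid_point c)).

Lemma grid_point_boundary (c : {ffun 'I_m.+1 -> nat}) i :
  (forall l, (c l <= N.+1.*2)%N) -> c i = 0%N \/ c i = N.+1.*2 ->
  cube_boundary (grid_point c).
Proof.
move=> cle ci; have N0 : 0 < N.+1%:R :> R by rewrite ltr0n.
split=> [l|]; last exists i; rewrite mxE.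
  have : (c l)%:R / N.+1%:R <= 2 :> R.
    by rewrite ler_pdivrMr // -natrM ler_nat mul2n.
  have : 0 <= (c l)%:R / N.+1%:R :> R by rewrite divr_ge0.
  by rewrite ler_norml; move: (_ / _) => q ? ?; apply/andP; split; lra.
case: ci => ->; first by rewrite mul0r sub0r normrN1.
by rewrite -mul2n natrM mulfK ?gt_eqF // (_ : 2 - 1 = 1 :> R) ?normr1 //; ring.
Qed.

Lemma sphere_point_in (c : {ffun 'I_m.+1 -> nat}) i :
  (forall l, (c l <= N.+1.*2)%N) -> c i = 0%N \/ c i = N.+1.*2 ->
  unit_sphere R m (sphere_point c).
Proof.
by move=> cle ci; apply/normalize_sphere/spread_gt0/(grid_point_boundary cle ci).
Qed.

Lemma sphere_pointN (c c' : {ffun 'I_m.+1 -> nat}) :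
  (forall l, (c l <= N.+1.*2)%N) ->
  (forall l, c' l = N.+1.*2 - c l)%N -> sphere_point c' = - sphere_point c.
Proof.
move=> cle c'E; rewrite /sphere_point -normalizeN -spreadN.
congr (normalize (spread _)); apply/rowP => l; rewrite !mxE c'E natrB //.
have N0 : N.+1%:R != 0 :> R by rewrite pnatr_eq0.
by rewrite -mul2n natrM mulrBl mulfK //; ring.
Qed.

Lemma sphere_point_local (c c' : {ffun 'I_m.+1 -> nat}) i :
  c i = 0%N \/ c i = N.+1.*2 ->
  (forall l : 'I_m.+1, (l <= i)%N -> c l = c' l) ->
  sphere_point c = sphere_point c'.
Proof.
move=> ci cc'; congr normalize; apply: (@spread_local _ _ i).
  have N0 : N.+1%:R != 0 :> R by rewrite pnatr_eq0.
  rewrite mxE; case: ci => ->; first by rewrite mul0r sub0r normrN1.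
  by rewrite -mul2n natrM mulfK // (_ : 2 - 1 = 1 :> R) ?normr1 //; ring.
by move=> l li; rewrite !mxE cc'.
Qed.

End SphereGrid.

Lemma sphere_grid (R : realType) (m : nat) (J : finType)
    (h : J -> 'rV[R]_m.+1 -> R) :
  (forall j, {within unit_sphere R m, continuous (h j)}) ->
  forall e : R, 0 < e -> exists N, forall c c' : {ffun 'I_m.+1 -> nat},
    (forall l, (c l <= N.+1.*2)%N) -> (exists i, c i = 0%N \/ c i = N.+1.*2) ->
    (forall l, (c' l <= N.+1.*2)%N) -> (exists i, c' i = 0%N \/ c' i = N.+1.*2) ->
    (forall l, (c l <= c' l + 2)%N /\ (c' l <= c l + 2)%N) ->
    forall j, `|h j (sphere_point R N c) - h j (sphere_point R N c')| < e.
Proof.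
move=> hc e e0.
have gc j y : cube_boundary y ->
    h j (normalize (spread z)) @[z --> within (@cube_boundary R m) (nbhs y)]
      --> h j (normalize (spread y)).
  move=> Cy; have ny := spread_gt0 Cy.
  have /subspace_continuousP hcj := hc j.
  apply: cvg_trans (hcj _ (normalize_sphere ny)).
  have cy : normalize (spread z) @[z --> nbhs y] --> normalize (spread y).
    apply: (@continuous_comp _ _ _ (@spread R m) (@normalize R m)).
      exact: spread_continuous.
    exact: normalize_continuous.
  move=> A Ah.
  have Ac : \forall z \near y, unit_sphere R m (normalize (spread z)) ->
    A (h j (normalize (spread z))) by exact: cy _ Ah.
  suff : \forall z \near y, cube_boundary z -> A (h j (normalize (spread z))) by [].
  near=> z => Cz; have : unit_sphere R m (normalize (spread z)).
    exact/normalize_sphere/spread_gt0.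
  by near: z.
have [r r0 rP] := compact_unif_within (@cube_boundary_compact R m) gc e0.
(* Doubled coordinates that differ by at most 2 give cube coordinates that differ by at most
   [2 / N.+1], which is below [r]. *)
pose N := Num.truncn (2 / r); exists N => c c' cle [i ci] c'le [i' ci'] cc' j.
apply: rP; [exact: grid_point_boundary ci|exact: grid_point_boundary ci'|].
have N0 : 0 < N.+1%:R :> R by rewrite ltr0n.
have Nr : 2 / N.+1%:R < r.
  by rewrite ltr_pdivrMr // mulrC -ltr_pdivrMr // truncnS_gt.
split=> // a b; rewrite (ord1 a) /ball /= !mxE.
have -> : (c b)%:R / N.+1%:R - 1 - ((c' b)%:R / N.+1%:R - 1) =
    ((c b)%:R - (c' b)%:R) / N.+1%:R :> R by rewrite mulrBl; ring.
rewrite normrM normfV (gtr0_norm N0).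
apply: le_lt_trans Nr; rewrite ler_pM2r ?invr_gt0 //.
have [cb cb'] := cc' b; rewrite ler_norml.
have : (c b)%:R <= (c' b)%:R + 2 :> R by rewrite -natrD ler_nat.
have : (c' b)%:R <= (c b)%:R + 2 :> R by rewrite -natrD ler_nat.
by move=> ? ?; apply/andP; split; lra.
Unshelve. all: by end_near. Qed.


End SphereApproximation.

(** * Cells of Hom complexes over a full simplex *)

Section HomCells.
Variables (V : finType) (n : nat) (s : {set V}).
Implicit Types (e : V -> {set 'I_n}).

(** A cell of the Hom complex from the simplex [s] to a full simplex: the join condition is then
    automatic. *)
Definition hom_cell e : Prop :=
  (forall v, v \in s -> e v != finset.set0) /\
  (forall u v, u \in s -> v \in s -> u != v -> [disjoint e u & e v]).

Definition total_card e : nat := \sum_(v in s) #|e v|.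

Definition min_lt (A B : {set 'I_n}) : bool :=
  [exists a in A, [forall b in B, (a < b)%N]].

(** The first component is the dimension of the cell, the second compares the least colors at [u]
    and [v]. *)
Definition hom_label (u v : V) e : label :=
  ((total_card e - #|s|)%N, min_lt (e u) (e v)).

Lemma min_ltC (A B : {set 'I_n}) : A != finset.set0 -> B != finset.set0 ->
  [disjoint A & B] -> min_lt B A = ~~ min_lt A B.
Proof.
move=> /set0Pn[a0 a0A] /set0Pn[b0 b0B] AB.
have [a aA amin] := arg_minnP (@nat_of_ord n) a0A.
have [b bB bmin] := arg_minnP (@nat_of_ord n) b0B.
have ab : a <> b :> nat.
  by move=> /val_inj E; have := disjointFr AB (aA : a \in A); rewrite E (bB : b \in B).
have E (A' B' : {set 'I_n}) (a' b' : 'I_n) : a' \in A' -> b' \in B' ->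
    (forall x, x \in A' -> (a' <= x)%N) -> (forall x, x \in B' -> (b' <= x)%N) ->
    min_lt A' B' = (a' < b')%N.
  move=> aA' bB' amin' bmin'; apply/existsP/idP.
    move=> [x /andP[xA /forallP /(_ b')]]; rewrite bB' /=.
    by apply: leq_ltn_trans; exact: amin'.
  move=> ab'; exists a'; rewrite aA'; apply/forallP => x; apply/implyP => xB.
  by apply: leq_trans ab' (bmin' _ xB).
by rewrite (E _ _ b a) // (E _ _ a b) //; lia.
Qed.

Lemma total_card_le e : hom_cell e -> (total_card e <= n)%N.
Proof.
move=> [_ e1]; rewrite /total_card.
under eq_bigr do rewrite -sum1_card big_mkcond.
rewrite exchange_big /= -[leqRHS]card_ord -sum1_card; apply: leq_sum => c _.
have [/existsP[v /andP[vs cv]]|] := boolP [exists v in s, c \in e v].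
  rewrite (bigD1 v) //= cv big1 // => u /andP[us uv]; case: ifP => // cu.
  by have /pred0P/(_ c) := e1 u v us vs uv; rewrite /= cu cv.
rewrite negb_exists => /forallP cN; rewrite big1 // => v vs.
by have := cN v; rewrite vs /= => /negbTE ->.
Qed.

Lemma total_card_ge e : hom_cell e -> (#|s| <= total_card e)%N.
Proof.
by move=> [e0 _]; rewrite -sum1_card; apply: leq_sum => v vs; rewrite card_gt0 e0.
Qed.

(** If some set grows strictly, so does the dimension; otherwise the two cells agree on [s] and have
    the same label. *)
Lemma hom_label_le u v e e' : u \in s -> v \in s -> hom_cell e -> hom_cell e' ->
  (forall x, x \in s -> e x \subset e' x) ->
  label_le (hom_label u v e) (hom_label u v e').
Proof.
move=> us vs ce ce' sub.
have [/existsP[x /andP[xs ex]]|] := boolP [exists x in s, e x != e' x].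
  rewrite /label_le /=; apply/orP; right; apply: ltn_sub2r.
    apply: leq_ltn_trans (total_card_ge ce) _.
    rewrite /total_card (bigD1 x) //= [ltnRHS](bigD1 x) //= -addSn leq_add //.
      by rewrite proper_card // finset.properEneq ex sub.
    by apply: leq_sum => y /andP[ys _]; rewrite subset_leq_card ?sub.
  rewrite /total_card (bigD1 x) //= [ltnRHS](bigD1 x) //= -addSn leq_add //.
    by rewrite proper_card // finset.properEneq ex sub.
  by apply: leq_sum => y /andP[ys _]; rewrite subset_leq_card ?sub.
rewrite negb_exists => /forallP H.
have eE x : x \in s -> e x = e' x.
  by move=> xs; have := H x; rewrite xs negbK => /eqP.
apply/orP; left; rewrite /hom_label (eE u us) (eE v vs) xpair_eqE eqxx andbT.
by apply/eqP; congr subn; apply: eq_bigr => x xs; rewrite eE.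
Qed.

End HomCells.

(** * Color sets along the grid *)

Section EtaGrid.
Variables (R : realType) (V W : finType) (n m N : nat) (col : W -> 'I_n).
Variable f : 'rV[R]_m.+1 -> V -> W -> R.

Definition cell_vertex (x c : {ffun 'I_m.+1 -> nat}) : bool :=
  [forall i, [&& ~~ odd (x i), (x i <= c i + 1)%N & (c i <= x i + 1)%N]].

Definition boundary_cell (c : {ffun 'I_m.+1 -> nat}) : Prop :=
  (forall i, (c i <= N.+1.*2)%N) /\ exists i, c i = 0%N \/ c i = N.+1.*2.

(** Below [1 / #|W|], so some barycentric coordinate always reaches it. On a fine grid, a coordinate
    reaching it at one vertex of a cell is positive at all vertices of that cell. *)
Definition threshold : R := #|W|.+1%:R^-1.

(** Collecting the colors over all vertices of the cell makes the sets grow along a chain of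
    faces. *)
Definition grid_eta (c : {ffun 'I_m.+1 -> nat}) (v : V) : {set 'I_n} :=
  finset (fun a : 'I_n => `[< exists x w, [/\ cell_vertex x c, col w = a &
    threshold <= f (sphere_point R N x) v w] >]).

Lemma grid_etaP c v a : reflect (exists x w, [/\ cell_vertex x c, col w = a &
    threshold <= f (sphere_point R N x) v w]) (a \in grid_eta c v).
Proof. by rewrite inE; apply: asboolP. Qed.

Lemma cell_vertexP (x c : {ffun 'I_m.+1 -> nat}) i : cell_vertex x c ->
  [/\ ~~ odd (x i), (x i <= c i + 1)%N & (c i <= x i + 1)%N].
Proof. by move=> /forallP/(_ i)/and3P. Qed.

Lemma cell_vertex_even (x c : {ffun 'I_m.+1 -> nat}) i :
  cell_vertex x c -> ~~ odd (c i) -> x i = c i.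
Proof. by move=> xc; have [] := cell_vertexP i xc; lia. Qed.

Lemma cell_vertex_extremal (x c : {ffun 'I_m.+1 -> nat}) i : cell_vertex x c ->
  c i = 0%N \/ c i = N.+1.*2 -> x i = 0%N \/ x i = N.+1.*2.
Proof.
move=> xc ci; rewrite (cell_vertex_even xc) //.
by case: ci => ->; rewrite ?odd_double.
Qed.

Lemma cell_vertex_boundary x c :
  cell_vertex x c -> boundary_cell c -> boundary_cell x.
Proof.
move=> xc [cle [i ci]]; split; last by exists i; apply: cell_vertex_extremal ci.
by move=> l; have [] := cell_vertexP l xc; have := cle l; lia.
Qed.

Definition base_vertex (c : {ffun 'I_m.+1 -> nat}) : {ffun 'I_m.+1 -> nat} :=
  [ffun i => (c i - odd (c i))%N].

Lemma base_vertexP c : cell_vertex (base_vertex c) c.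
Proof.
apply/forallP => i; rewrite ffunE; apply/and3P; split; try lia.
Qed.

Lemma grid_eta_mono (c c' : {ffun 'I_m.+1 -> nat}) v :
  (forall x, cell_vertex x c -> cell_vertex x c') ->
  grid_eta c v \subset grid_eta c' v.
Proof.
move=> cc'; apply/fintype.subsetP => a /grid_etaP[x [w [xc wa fx]]].
by apply/grid_etaP; exists x, w; split=> //; exact: cc'.
Qed.

Lemma grid_eta_local_sub (c c' : {ffun 'I_m.+1 -> nat}) (i : 'I_m.+1) v :
  c i = 0%N \/ c i = N.+1.*2 -> (forall l : 'I_m.+1, (l <= i)%N -> c l = c' l) ->
  grid_eta c v \subset grid_eta c' v.
Proof.
move=> ci cc'; apply/fintype.subsetP => a /grid_etaP[x [w [xc wa fx]]].
(* Keep [x] up to [i] and complete it by a vertex of [c']; the sphere point ignores the coordinates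
   after the extremal one. *)
pose x' : {ffun 'I_m.+1 -> nat} :=
  [ffun l : 'I_m.+1 => if (l <= i)%N then x l else base_vertex c' l].
apply/grid_etaP; exists x', w; split=> //.
  apply/forallP => l; rewrite !ffunE; case: leqP => li.
    by rewrite -cc' //; apply/and3P; exact: cell_vertexP.
  by have /forallP/(_ l) := base_vertexP c'; rewrite ffunE.
rewrite -(@sphere_point_local R m N x x' i) //.
  exact: cell_vertex_extremal ci.
by move=> l li; rewrite !ffunE li.
Qed.

Lemma grid_eta_local (c c' : {ffun 'I_m.+1 -> nat}) (i : 'I_m.+1) :
  c i = 0%N \/ c i = N.+1.*2 -> (forall l : 'I_m.+1, (l <= i)%N -> c l = c' l) ->
  grid_eta c =1 grid_eta c'.
Proof.
move=> ci cc' v; apply/eqP; rewrite finset.eqEsubset (grid_eta_local_sub _ ci cc') /=.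
by apply: (@grid_eta_local_sub c' c i) => [|l li]; rewrite -cc'.
Qed.

Section Antipode.
Variable omega : V -> V.
Hypothesis omegaK : involutive omega.
Hypothesis f_odd : forall x v, unit_sphere R m x -> f (- x) v = f x (omega v).

Lemma cell_vertex_opp (x c : {ffun 'I_m.+1 -> nat}) : boundary_cell c ->
  cell_vertex x c -> cell_vertex (opp_cell N x) (opp_cell N c).
Proof.
move=> [cle _] xc; apply/forallP => i; rewrite !ffunE.
have [x0 x1 x2] := cell_vertexP i xc; have := cle i.
by move=> ci; apply/and3P; split; lia.
Qed.

Lemma opp_boundary c : boundary_cell c -> boundary_cell (opp_cell N c).
Proof.
move=> [cle [i ci]]; split=> [l|]; first by rewrite ffunE; lia.
by exists i; rewrite ffunE; lia.
Qed.

Lemma opp_cellK c : boundary_cell c -> opp_cell N (opp_cell N c) = c.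
Proof. by move=> [cle _]; apply/ffunP => l; rewrite !ffunE subKn. Qed.

Lemma grid_eta_opp_sub c v : boundary_cell c ->
  grid_eta c (omega v) \subset grid_eta (opp_cell N c) v.
Proof.
move=> bc; apply/fintype.subsetP => a /grid_etaP[x [w [xc wa fx]]].
apply/grid_etaP; exists (opp_cell N x), w; split=> //.
  exact: cell_vertex_opp.
have [xle [i xi]] := cell_vertex_boundary xc bc.
rewrite (@sphere_pointN R m N x) //; last by move=> l; rewrite ffunE.
by rewrite f_odd //; exact: sphere_point_in xi.
Qed.

Lemma grid_eta_opp c v : boundary_cell c ->
  grid_eta (opp_cell N c) v = grid_eta c (omega v).
Proof.
move=> bc; apply/eqP; rewrite finset.eqEsubset grid_eta_opp_sub // andbT.
have := grid_eta_opp_sub (omega v) (opp_boundary bc).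
by rewrite omegaK opp_cellK.
Qed.

End Antipode.

Section Validity.
Variables (Gamma : simplicial_complex V) (K : simplicial_complex W).
Hypothesis f_hom : forall x, unit_sphere R m x -> hom_complex R Gamma K (f x).
Hypothesis col_nondeg : Defs.nondegenerate K col.
Hypothesis f_grid : forall x y : {ffun 'I_m.+1 -> nat},
  boundary_cell x -> boundary_cell y ->
  (forall l, (x l <= y l + 2)%N /\ (y l <= x l + 2)%N) ->
  forall v w, `|f (sphere_point R N x) v w - f (sphere_point R N y) v w|
    < threshold.

Lemma grid_eta_neq0 c v : boundary_cell c -> grid_eta c v != finset.set0.
Proof.
move=> bc; have [xle [i xi]] := cell_vertex_boundary (base_vertexP c) bc.
have [e _ /(_ v)[f0 f1 _]] := f_hom (sphere_point_in R xle xi).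
have [/existsP[w fw]|] := boolP [exists w,
    threshold <= f (sphere_point R N (base_vertex c)) v w].
  apply/set0Pn; exists (col w); apply/grid_etaP.
  by exists (base_vertex c), w; split=> //; exact: base_vertexP.
rewrite negb_exists => /forallP H; exfalso.
have : \sum_w f (sphere_point R N (base_vertex c)) v w <= \sum_(w : W) threshold.
  by apply: ler_sum => w _; apply: ltW; rewrite ltNge H.
rewrite f1 sumr_const -mulr_natl /threshold ler_pdivlMr ?ltr0n // mul1r ler_nat.
by rewrite ltnn.
Qed.

(** A common color comes from [w] over [u] and [w'] over [v], both with positive weight at one
    vertex [y] of the cell. They lie in a simplex of [K] and have equal colors, so [w = w'], against
    the disjointness in the cell containing [f] at [y]. *)
Lemma grid_eta_disjoint c u v : boundary_cell c -> u != v ->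
  [set u; v]%SET \in simplices Gamma -> [disjoint grid_eta c u & grid_eta c v].
Proof.
move=> bc uv uvG; apply/pred0P => a /=; apply/negP.
case/andP => /grid_etaP[x [w [xc wa fx]]] /grid_etaP[y [w' [yc w'a fy]]].
have bx := cell_vertex_boundary xc bc; have by_ := cell_vertex_boundary yc bc.
have xy l : (x l <= y l + 2)%N /\ (y l <= x l + 2)%N.
  by have [_ ? ?] := cell_vertexP l xc; have [_ ? ?] := cell_vertexP l yc; lia.
have fyw : 0 < f (sphere_point R N y) u w.
  have := f_grid bx by_ xy u w; rewrite ltr_norml => /andP[_]; lra.
have fyw' : 0 < f (sphere_point R N y) v w'.
  by apply: lt_le_trans fy; rewrite /threshold invr_gt0 ltr0n.
have [yle [i yi]] := by_.
have [e [e0 e1 e2] eP] := f_hom (sphere_point_in R yle yi).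
have ew : w \in e u.
  by apply/negPn/negP => /(let: And3 _ _ z := eP u in z) E; rewrite E ltxx in fyw.
have ew' : w' \in e v.
  by apply/negPn/negP => /(let: And3 _ _ z := eP v in z) E; rewrite E ltxx in fyw'.
have ww' : w = w'.
  pose c0 z := if z == u then w else w'.
  have c0P : {in [set u; v]%SET, forall z, c0 z \in e z}.
    move=> z; rewrite !inE /c0; case: eqP => [-> //|_] /= /eqP -> //.
  have := e2 _ _ uvG c0P; rewrite imsetU1 imset_set1 /c0 eqxx.
  rewrite eq_sym (negbTE uv) => ww'K; apply: (col_nondeg ww'K).
  - by rewrite !inE eqxx.
  - by rewrite !inE eqxx orbT.
  - by rewrite wa.
have /finset.setP/(_ w) := e1 _ _ uv uvG.
by rewrite !inE ew ww' ew'.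
Qed.

End Validity.
End EtaGrid.

(** * Parallel transport *)

Lemma edge_simplex (V : finType) (G : simplicial_complex V) d (A : {set V}) u v :
  is_simplex G d A -> u \in A -> v \in A -> [set u; v]%SET \in simplices G.
Proof.
move=> /andP[AG _] uA vA; apply: complex_face AG _ _.
  by apply/fintype.subsetP => x; rewrite !inE => /orP[] /eqP ->.
by apply/set0Pn; exists u; rewrite !inE eqxx.
Qed.

Lemma boundary_face (N m : nat) (p : flag N m) j :
  on_boundary p -> (j <= m)%N -> boundary_cell N (face p j).
Proof.
move=> bp jm; split=> [i|].
  rewrite ffunE; have := corner_le p i; have := ltn_ord (p.1.1 i).
  by case: ifP => _; lia.
exists (at_rank p m); have := @face_extremal N m p j (at_rank p m).
by rewrite at_rankK // => /(_ jm bp) /orP[] /eqP; auto.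
Qed.

Lemma face_vertex (N m : nat) (p : flag N m) j x :
  cell_vertex x (face p j) -> cell_vertex x (face p j.+1).
Proof.
move=> xc; apply/forallP => i; have [x0 x1 x2] := cell_vertexP i xc.
apply/and3P; move: x1 x2; rewrite !ffunE ltnS /corner.
case: (ltngtP (p.2 i) j) => // _; case: (p.1.2 i) => /= x1 x2; split => //; lia.
Qed.

Lemma eq_degree (N m : nat) (L L' : cell m -> label) :
  (forall (p : flag N m) j, on_boundary p -> (j <= m)%N ->
     L (face p j) = L' (face p j)) ->
  degree N L = degree N L'.
Proof.
move=> LL'; apply: eq_bigr => p bp; congr (_ * (nat_of_bool _)%:R).
by apply: eq_forallb => j /=; rewrite LL' // -ltnS.
Qed.

Section Transport.
Variables (V : finType) (n m N d : nat) (s : {set V}) (u0 v0 : V).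
Hypotheses (u0s : u0 \in s) (v0s : v0 \in s) (cs : #|s| = d.+1).
Hypothesis nm : (n <= m + d + 1)%N.

Definition hom_family (E : cell m -> V -> {set 'I_n}) : Prop :=
  forall p : flag N m, on_boundary p ->
    (forall j, (j <= m)%N -> hom_cell s (E (face p j))) /\
    (forall j v, (j < m)%N -> v \in s ->
       E (face p j) v \subset E (face p j.+1) v).

Lemma hom_label_rank (e : V -> {set 'I_n}) : hom_cell s e -> ((hom_label s u0 v0 e).1 <= m)%N.
Proof.
move=> /total_card_le en; rewrite /= cs leq_subLR addSnnS addnC addSn -addn1.
exact: leq_trans nm.
Qed.

Lemma hom_family_mono E p j : hom_family E -> on_boundary p -> (j < m)%N ->
  label_le (hom_label s u0 v0 (E (face p j)))
    (hom_label s u0 v0 (E (face (p : flag N m) j.+1))).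
Proof.
move=> EF bp jm; have [Ec Es] := EF p bp.
by apply: hom_label_le => //; [apply: Ec; exact: ltnW|exact: Ec|move=> v; exact: Es].
Qed.

Lemma degree_sub (E E' : cell m -> V -> {set 'I_n}) :
  hom_family E -> hom_family E' ->
  (forall (p : flag N m) j v, on_boundary p -> (j <= m)%N -> v \in s ->
     E (face p j) v \subset E' (face p j) v) ->
  degree N (hom_label s u0 v0 \o E) = degree N (hom_label s u0 v0 \o E').
Proof.
move=> EF EF' EE'; apply: degree_le => p j bp jm; rewrite [_ \o _]lock /= -lock.
- exact: hom_family_mono.
- exact: hom_family_mono.
- have [Ec _] := EF p bp; have [Ec' _] := EF' p bp.
  by apply: hom_label_le => //; [exact: Ec|exact: Ec'|move=> v vs; exact: EE'].
- by apply: hom_label_rank; have [] := EF p bp; auto.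
- by apply: hom_label_rank; have [] := EF' p bp; auto.
Qed.

Variables (Gamma : simplicial_complex V) (eta : cell m -> V -> {set 'I_n}).
Hypothesis eta0 : forall c v, boundary_cell N c -> eta c v != finset.set0.
Hypothesis eta_disj : forall c u v, boundary_cell N c -> u != v ->
  [set u; v]%SET \in simplices Gamma -> [disjoint eta c u & eta c v].
Hypothesis eta_mono : forall (p : flag N m) j v,
  eta (face p j) v \subset eta (face p j.+1) v.

Lemma hom_family_comp (A : {set V}) (b : V -> V) : is_simplex Gamma d A ->
  {in s &, injective b} -> {in s, forall v, b v \in A} ->
  hom_family (fun c => eta c \o b).
Proof.
move=> AG binj bA p bp; split=> [j jm|j v jm vs]; last exact: eta_mono.
have bc := boundary_face bp jm; split=> [v vs|u v us vs uv]; first exact: eta0.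
apply: eta_disj => //; last by apply: edge_simplex AG _ _; exact: bA.
by apply: contra_neq uv; exact: binj.
Qed.

(* Replacing one d-simplex by an adjacent one moves a single vertex, and the
   union of the two families is again a family of cells because the target is
   a full simplex: this is where the coloring enters. *)
Lemma degree_perspectivity (A B : {set V}) (b : V -> V) :
  is_simplex Gamma d A -> is_simplex Gamma d B -> Defs.adjacent d A B ->
  {in s &, injective b} -> {in s, forall v, b v \in A} ->
  [/\ {in s &, injective (perspectivity A B \o b)},
      {in s, forall v, perspectivity A B (b v) \in B}
    & degree N (fun c => hom_label s u0 v0 (eta c \o b)) =
      degree N (fun c => hom_label s u0 v0 (eta c \o (perspectivity A B \o b)))].
Proof.
move=> AG BG /existsP[F /and3P[FA FB /eqP cF]] binj bA.
have /andP[_ /eqP cA] := AG; have /andP[_ /eqP cB] := BG.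
have [_ pinj pAB] := perspectivityP cA cB FA FB cF.
set b' := perspectivity A B \o b.
have binj' : {in s &, injective b'}.
  by move=> x y xs ys /pinj E; apply: binj => //; apply: E; exact: bA.
have bB v : v \in s -> b' v \in B by move=> vs; have := imset_f (perspectivity A B) (bA v vs); rewrite pAB.
split=> //.
(* At most one vertex of [A] lies outside [B], so of two distinct vertices one is not moved. *)
have moved v w : v \in s -> w \in s -> v != w -> b' v = b v \/ b' w = b w.
  move=> vs ws vw.
  have [vB|vB] := boolP (b v \in B); first by left; rewrite /b' /= /perspectivity vB.
  have [wB|wB] := boolP (b w \in B); first by right; rewrite /b' /= /perspectivity wB.
  have : (#|A :\: B| <= 1)%N.
    rewrite -(leq_add2l #|F|) {2}cF addn1 -cA -(cardsID F A).
    by rewrite (finset.setIidPr FA) leq_add2l; apply/subset_leq_card/finset.setDS.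
  move=> /card_le1_eqP/(_ (b v) (b w)); rewrite !inE vB wB !bA // => /(_ isT isT).
  by move=> bvw; move: vw; rewrite (binj _ _ ws vs bvw) eqxx.
pose E0 c := eta c \o b; pose E1 c := eta c \o b'.
pose E c v := (E0 c v :|: E1 c v)%SET.
have F0 : hom_family E0 by exact: hom_family_comp AG binj bA.
have F1 : hom_family E1 by exact: hom_family_comp BG binj' bB.
have FE : hom_family E.
  move=> p bp; have [c0 s0] := F0 p bp; have [c1 s1] := F1 p bp.
  split=> [j jm|j v jm vs]; last by apply: finset.setUSS; [exact: s0|exact: s1].
  have bc := boundary_face bp jm.
  have [n0 d0] := c0 j jm; have [_ d1] := c1 j jm; split=> [v vs|v w vs ws vw].
    have /set0Pn[a av] := n0 v vs.
    by apply/set0Pn; exists a; rewrite inE av.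
  (* Since one of the two vertices is not moved, both sets belong to the same family. *)
  have cross x y : x \in s -> y \in s -> x != y ->
      [disjoint E0 (face p j) x & E1 (face p j) y].
    move=> xs ys xy; case: (moved x y xs ys xy) => [xE|yE].
      by have := d1 x y xs ys xy; rewrite /E1 /E0 /= xE.
    by have := d0 x y xs ys xy; rewrite /E1 /E0 /= yE.
  rewrite -setI_eq0 finset.setIUl !finset.setIUr !finset.setU_eq0 !setI_eq0.
  rewrite d0 // d1 // cross //= andbT disjoint_sym cross // eq_sym //.
transitivity (degree N (hom_label s u0 v0 \o E)).
  by apply: (degree_sub F0 FE) => p j v bp jm vs; exact: finset.subsetUl.
symmetry; apply: (degree_sub F1 FE) => p j v bp jm vs; exact: finset.subsetUr.
Qed.

Lemma degree_projectivity (w : seq {set V}) (A : {set V}) (b : V -> V) :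
  all (is_simplex Gamma d) (A :: w) -> path (Defs.adjacent d) A w ->
  {in s &, injective b} -> {in s, forall v, b v \in A} ->
  degree N (fun c => hom_label s u0 v0 (eta c \o b)) =
  degree N (fun c => hom_label s u0 v0 (eta c \o (projectivity A w \o b))).
Proof.
elim: w A b => [//|B w IH] A b /andP[AG wG] /= /andP[AB wB] binj bA.
have /andP[BG _] := wG.
have [binj' bB ->] := degree_perspectivity AG BG AB binj bA.
exact: (IH B (perspectivity A B \o b)).
Qed.

End Transport.

(** * The contradiction between an odd and a vanishing degree *)

Lemma ptws_coord_within (R : realType) (T : topologicalType) (V W : finType)
    (A : set T) (f : T -> {ptws V -> {ptws W -> R}}) v w :
  {within A, continuous f}%classic -> {within A, continuous (fun x => f x v w)}%classic.
Proof.
move=> fc x.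
apply: (@continuous_comp _ _ _ (fun x : subspace A => f x v) (fun q => q w)).
  apply: (@continuous_comp _ _ _ (f : subspace A -> _) (fun q => q v)).
    exact: fc.
  exact: (@proj_continuous V (fun=> {ptws W -> R}) v).
exact: (@proj_continuous W (fun=> R) w).
Qed.

Theorem theorem4p21 (R : realType) (V W : finType) (d : nat)
    (Gamma : simplicial_complex V) (omega : {perm V}) (sigma : {set V})
    (K : simplicial_complex W) (m : nat) :
  Phi_complex Gamma d omega sigma ->
  pure K d ->
  ~~ odd m ->
  coind_ge R (hom_complex R Gamma K) (hom_map omega) m ->
  (m + d + 2 <= chromatic_number K)%N.
Proof.
move=> [_ _ omegaK [sG osE] [tauP tau1]] _ m_even [f [fc fX fodd]].
rewrite /chromatic_number; case: ex_minnP => n /asboolP[col [_ col_nd]] _.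
rewrite leqNgt; apply/negP => nlt.
have nm : (n <= m + d + 1)%N by lia.
have t0 : 0 < threshold R W by rewrite /threshold invr_gt0 ltr0n.
have [N gridP] := sphere_grid (h := fun j : V * W => fun x => f x j.1 j.2)
  (fun j => ptws_coord_within (v := j.1) (w := j.2) fc) t0.
pose eta : cell m -> V -> {set 'I_n} := grid_eta N col f.
have eta0 c v : boundary_cell N c -> eta c v != finset.set0.
  exact: (grid_eta_neq0 col fX).
have eta_disj c u v : boundary_cell N c -> u != v ->
    [set u; v]%SET \in simplices Gamma -> [disjoint eta c u & eta c v].
  apply: (grid_eta_disjoint fX col_nd) => x y [xle xb] [yle yb] xy v' w'.
  exact: (gridP x y xle xb yle yb xy (v', w')).
have eta_mono (p : flag N m) j v : eta (face p j) v \subset eta (face p j.+1) v.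
  by apply: grid_eta_mono => x; exact: face_vertex.
have eta_opp c v : boundary_cell N c -> eta (opp_cell N c) v = eta c (omega v).
  apply: grid_eta_opp => // x v' Sx; exact: (congr1 (fun q => q v') (fodd x Sx)).
have oS v : v \in sigma -> omega v \in sigma by move=> vs; rewrite -osE imset_f.
have tauE v : v \in sigma -> restr_perm sigma omega v = omega v.
  apply: restr_permE; apply/astabsP => x; rewrite /= /aperm.
  by apply/idP/idP => [/oS|/oS //]; rewrite omegaK.
(* Non-triviality of tau supplies the pair [v0], [omega v0] whose least colors define the sign. *)
have [v0 v0s v0N] : exists2 v, v \in sigma & omega v != v.
  have [/existsP[v /andP[vs vN]]|] := boolP [exists v in sigma, omega v != v].
    by exists v.
  rewrite negb_exists => /forallP H; case/eqP: tau1; apply/permP => v.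
  rewrite perm1; have [vs|vs] := boolP (v \in sigma).
    by rewrite tauE //; have := H v; rewrite vs negbK => /eqP.
  by apply: (out_perm (restr_perm_on _ _)).
have cs : #|sigma| = d.+1 by case/andP: sG => _ /eqP.
have ov0 := oS _ v0s.
pose L (b : V -> V) (c : cell m) := hom_label sigma v0 (omega v0) (eta c \o b).
have Fid : hom_family N sigma (fun c => eta c \o id).
  by apply: (hom_family_comp eta0 eta_disj eta_mono sG) => //; move=> x y _ _.
have Dtau : degree N (L id) = degree N (L omega).
  have : restr_perm sigma omega \in projectivities Gamma d sigma by [].
  rewrite inE => /andP[_ /asboolP[w [wG wP _ wE]]].
  have idinj : {in sigma &, injective (@id V)} by move=> x y _ _.
  rewrite /L (degree_projectivity v0s ov0 cs nm eta0 eta_disj eta_mono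
    wG wP idinj) //.
  (* The chain of simplices realizes tau on [sigma], and labels read only vertices of [sigma]. *)
  have E v : v \in sigma -> projectivity sigma w v = omega v.
    by move=> vs; rewrite -wE // tauE.
  apply: eq_degree => p j _ _; rewrite /hom_label /= !E //; congr (_ - _, _)%N.
  by apply: eq_bigr => v vs /=; rewrite E.
have Dopp : degree N (L omega) = - degree N (L id).
  have -> : - degree N (L id) = degree N (L id \o @opp_cell N m).
    by rewrite degree_opp -signr_odd /= m_even mulN1r.
  apply: eq_degree => p j bp jm; rewrite /L /= ; congr hom_label.
  by apply/funext => v /=; rewrite eta_opp //; exact: boundary_face.
have D1 : (degree N (L id))%:~R = 1 :> 'F_2.
  apply: degree_odd.
  - move=> p j i ext.
    have bc : boundary_cell N (face p j).
      split; last by exists i; case/orP: ext => /eqP; auto.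
      move=> l; rewrite ffunE; have := corner_le p l; have := ltn_ord (p.1.1 l).
      by case: ifP => _; lia.
    (* The antipode exchanges the disjoint color sets of [v0] and [omega v0], which reverses the
       comparison of their minima. *)
    rewrite /L /= !eta_opp // omegaK; apply: min_ltC; try exact: eta0.
    by apply: eta_disj => //; [rewrite eq_sym|apply: edge_simplex sG v0s ov0].
  - move=> c c' i ext cc'; rewrite /L; congr hom_label; apply/funext => v /=.
    by apply: (@grid_eta_local R V W n m N col f c c' i) => //; case/orP: ext => /eqP; auto.
  - move=> p j bp jm; exact: (hom_family_mono v0s ov0 Fid bp jm).
  - move=> p j bp jm; apply: (hom_label_rank v0 (omega v0) cs nm).
    by have [] := Fid p bp; auto.
(* The degree equals its opposite in [int], so it is zero and cannot be odd. *)
have : degree N (L id) = 0 by move: Dtau; rewrite Dopp; lia.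
by move=> D0; move: D1; rewrite D0.
Qed.
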